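(* Let $X$ be a finite CW complex with oriented cells, let $d\ge 1$, let $z_d=\operatorname{rank} Z_d(X;\mathbb Z)$, let $\{z_r\}_{r=1}^{z_d}$ be a $\mathbb Z$-basis of $Z_d(X;\mathbb Z)$, and let $M\{z_r\}=(\langle z_i,z_j\rangle)_{i,j}$ be the associated mesh matrix on $d$-cycles. Write $\sigma_m(M)$ for the $m$-th elementary symmetric function of the eigenvalues of $M$. (1) The constant coefficient of $(-1)^{z_d}\det(t\,\mathrm{Id}-M\{z_r\})$ is $$\det(M\{z_r\})=\sigma_{z_d}(M\{z_r\})=\sum_{V}\left(\frac{t_{d-1}(X_V)}{t_{d-1}(X)}\right)^2,$$ the sum being over all $d$-dimensional spanning forests $V$ of $X$. Moreover, for every $d$-dimensional spanning forest $V$, $$\det(j_V\cdot j_V^\star)=\left(\frac{t_{d-1}(X_V)}{t_{d-1}(X)}\right)^2 .$$ (2) If $0<k<z_d$, then the coefficient of $(-1)^{z_d-k}t^{k}$ in $\det(t\,\mathrm{Id}-M\{z_r\})$ is $$\sigma_{z_d-k}(M\{z_r\})=\sum_{W}\left(\frac{t_{d-1}(X_W)}{t_{d-1}(X)}\right)^2\det\big(B[W]^tB[W]\big),$$ the sum being over all $d$-dimensional $k$ augmented spanning forests $W$ of $X$. (3) For every $k$ augmented spanning forest $W$ with $0\le k<z_d$, $$\det(j_W\cdot j_W^\star)=\left(\frac{t_{d-1}(X_W)}{t_{d-1}(X)}\right)^2\det\big(B[W]^tB[W]\big).$$ (4) For every $k$ augmented spanning forest $W$ (in particular for $k=0$),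 $\dfrac{t_{d-1}(X_W)}{t_{d-1}(X)}$ is a positive integer.
   Context: $C_i(X;\cdot)$, $Z_i(X;\cdot)$, $B_i(X;\cdot)$ are the cellular $i$-chains, $i$-cycles and $i$-boundaries; $b_i=\operatorname{rank}B_i(X;\mathbb Z)$. $S_d$ is the set of (oriented) $d$-cells of $X$; it is the cellular basis of $C_d(X;\mathbb Z)$, and $\langle\cdot,\cdot\rangle$ is the bilinear pairing on $C_d(X;\mathbb Z)$ for which this basis is orthonormal. The mesh matrix uses this pairing restricted to cycles. For $V\subset S_d$, $X_V=X^{(d-1)}\cup V$ is the subcomplex consisting of the $(d-1)$-skeleton and the cells of $V$, and $V^c=S_d\setminus V$. A $d$-dimensional spanning forest of $X$ is a subset $V\subset S_d$ with $|V|=b_{d-1}$ and $Z_d(X_V;\mathbb R)=0$. For $0\le k\le z_d$, a $k$ augmented spanning forest is a subset $W\subset S_d$ obtained by adding $k$ further $d$-cells to some spanning forest; equivalently, $|W^c|=z_d-k$ and the restriction $Z_d(X;\mathbb R)\subset C_d(X;\mathbb R)\to C_d(X_{W^c};\mathbb R)$ is onto. A spanning forest is a $0$ augmented spanning forest. $t_i(Y)$ denotes the order of the torsion subgroup of $H_i(Y;\mathbb Z)$. For a $k$ augmented spanning forest $W$, $j_W:Z_d(X;\mathbb Z)\subset C_d(X;\mathbb Z)\to C_d(X_{W^c};\mathbb Z)$ is the inclusion followed by restriction of chains to the cells of $W^c$, and $j_W^\star:C_d(X_{W^c};\mathbb Z)\to Z_d(X;\mathbb Z)$ is its adjoint when $\{z_r\}$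 and the cellular basis $W^c$ of $C_d(X_{W^c};\mathbb Z)$ are both declared orthonormal (so if $U_W$ is the matrix of $j_W$ in these bases, $\det(j_W j_W^\star)=\det(U_WU_W^t)$; it is called the covolume squared of $j_W^\star$). $Z_d(X_W;\mathbb Z)$ has rank $k$; $B[W]$ is the $z_d\times k$ integer matrix of the inclusion $Z_d(X_W;\mathbb Z)\subset Z_d(X;\mathbb Z)$ with respect to an arbitrary $\mathbb Z$-basis of $Z_d(X_W;\mathbb Z)$ and the basis $\{z_r\}$; $\det(B[W]^tB[W])$ does not depend on the basis of $Z_d(X_W;\mathbb Z)$, and equals $1$ by convention if $k=0$. *)

(* Defs.v *)
From HB Require Import structures.
From mathcomp Require Import all_boot all_order all_algebra all_field finmap.
From mathcomp Require Import all_classical all_reals all_analysis.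

Set Implicit Arguments.
Unset Strict Implicit.
Unset Printing Implicit Defensive.

Import Order.TTheory GRing.Theory Num.Theory.
Import numFieldNormedType.Exports.

Local Open Scope ring_scope.

Definition std_simplex (R : realType) (n : nat) : set 'rV[R]_n.+1 :=
  [set x | (forall i, 0 <= x ord0 i) /\ \sum_i x ord0 i = 1]%classic.
Arguments std_simplex : clear implicits.

Definition interior_point (R : realType) (n : nat) (x : std_simplex R n) : Prop :=
  forall i, 0 < (val x : 'rV[R]_n.+1) ord0 i.

Definition coface_row (R : realType) (n : nat) (i : 'I_n.+2) (x : 'rV[R]_n.+1) :
  'rV[R]_n.+2 := \row_j oapp (x ord0) 0 (unlift i j).

Lemma coface_subproof (R : realType) (n : nat) (i : 'I_n.+2) (x : std_simplex R n) :
  coface_row i (val x) \in std_simplex R n.+1.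
Proof.
have [x0 x1] := set_mem (valP x); apply/mem_set; split.
  by move=> j; rewrite mxE; case: unlift => [k|] /=.
rewrite (bigD1_ord i) //= mxE unlift_none add0r -x1.
by apply: eq_bigr => j _; rewrite mxE liftK.
Qed.

Definition coface (R : realType) (n : nat) (i : 'I_n.+2) (x : std_simplex R n) :
  std_simplex R n.+1 := exist (fun y => y \in std_simplex R n.+1) _ (coface_subproof i x).

(* Simplices of all dimensions at once, so that a map and its dimension travel
   together.  Continuity is not built in: it is required of the simplices of a
   chain, in [singular_chain]. *)
Definition simplex (R : realType) (X : Type) : Type :=
  {n : nat & std_simplex R n -> X}.

Definition simplex_face (R : realType) (X : Type) (n : nat)
    (f : std_simplex R n.+1 -> X) (i : 'I_n.+2) : simplex R X :=
  Tagged (fun m => std_simplex R m -> X) (f \o coface i).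

(* Formal integer combinations of simplices are functions [simplex R X -> int]
   of finite support. *)
Definition elem_chain (R : realType) (X : topologicalType) (f : simplex R X) :
  simplex R X -> int := fun g => (`[< g = f >])%:R.

Definition elem_bd (R : realType) (X : topologicalType) (f : simplex R X) :
    simplex R X -> int :=
  match f with
  | existT 0 _ => 0
  | existT n.+1 g => \sum_(i < n.+2) elem_chain (simplex_face g i) *~ (-1) ^+ i
  end.

Definition singular_bd (R : realType) (X : topologicalType)
    (c : simplex R X -> int) : simplex R X -> int :=
  \sum_(f \in [set: simplex R X]%classic) (elem_bd f *~ c f).

Definition singular_chain (R : realType) (X : topologicalType) (A : set X)
    (n : nat) (c : simplex R X -> int) : Prop :=
  finite_set [set f | c f != 0]%classic /\
  (forall f, c f != 0 ->
     [/\ tag f = n, continuous (tagged f) & forall x, A (tagged f x)]).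

(* The closed n-ball is modelled by the standard n-simplex; a cell is oriented
   by the vertex order through its characteristic map.  That the topology is
   the weak one and that the characteristic maps are homeomorphisms on open
   cells follow from Hausdorffness and finiteness. *)
Record finite_CW (R : realType) := FiniteCW {
  cw_space :> topologicalType;
  cw_hausdorff : hausdorff_space cw_space;
  cell : finType;
  char_map : cell -> simplex R cw_space;
  char_map_continuous : forall s, continuous (tagged (char_map s));
  char_map_inj : forall s (x y : std_simplex R (tag (char_map s))),
    interior_point x -> interior_point y ->
    tagged (char_map s) x = tagged (char_map s) y -> x = y;
  open_cells_partition : forall p : cw_space, exists! s,
    exists2 x, interior_point x & tagged (char_map s) x = p;
  char_map_boundary : forall s (x : std_simplex R (tag (char_map s))),
    ~ interior_point x ->
    exists2 t, (tag (char_map t) < tag (char_map s))%N &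
    exists2 y, interior_point y & tagged (char_map t) y = tagged (char_map s) x
}.

Definition cdim (R : realType) (X : finite_CW R) (s : cell X) : nat :=
  tag (char_map s).

Definition open_cell (R : realType) (X : finite_CW R) (s : cell X) : set X :=
  (tagged (char_map s) @` [set x | interior_point x])%classic.

(* The (m-1)-skeleton; empty for m = 0. *)
Definition skeleton_lt (R : realType) (X : finite_CW R) (m : nat) : set X :=
  [set p | exists2 s : cell X, (cdim s < m)%N & open_cell s p]%classic.
Arguments skeleton_lt {R} X m.

(* C_n = H_n(X^n, X^(n-1)) is free on the classes of the characteristic maps of
   the n-cells, and the cellular boundary is the connecting homomorphism
   C_n -> C_(n-1).  Thus [inc s t] is determined by: the singular boundary of
   the characteristic map of s equals [\sum_t inc s t * t] modulo chains of
   X^(n-2) and boundaries of chains of X^(n-1). *)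
Record cellular_complex (R : realType) (X : finite_CW R) := CellularComplex {
  inc : cell X -> cell X -> int;
  inc_cdim : forall s t, inc s t != 0 -> cdim s = (cdim t).+1;
  inc_connecting : forall s : cell X, exists a b : simplex R X -> int,
    [/\ singular_chain (skeleton_lt X (cdim s).-1) (cdim s).-1 a,
        singular_chain (skeleton_lt X (cdim s)) (cdim s) b &
        elem_bd (char_map s) =
        \sum_t elem_chain (char_map t) *~ inc s t + a + singular_bd b];
  inc_inc : forall s u : cell X, \sum_t inc s t * inc t u = 0
}.

(* Chains with coefficients in A are functions on the set of all cells; a
   subcomplex is given by the set Y of its cells. *)
Definition is_chain (R : realType) (X : finite_CW R) (A : zmodType)
    (Y : {set cell X}) (i : nat) : {pred {ffun cell X -> A}} :=
  fun c => [forall s, (c s != 0) ==> (s \in Y) && (cdim s == i)].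

Definition bd (R : realType) (X : finite_CW R) (C : cellular_complex X)
    (A : zmodType) (c : {ffun cell X -> A}) : {ffun cell X -> A} :=
  [ffun t => \sum_s c s *~ inc C s t].

Definition is_cycle (R : realType) (X : finite_CW R) (C : cellular_complex X)
    (A : zmodType) (Y : {set cell X}) (i : nat) : {pred {ffun cell X -> A}} :=
  fun c => is_chain Y i c && (bd C c == 0).
Arguments is_cycle {R X} C A Y i.

Definition is_boundary (R : realType) (X : finite_CW R) (C : cellular_complex X)
    (Y : {set cell X}) (i : nat) : {pred {ffun cell X -> int}} :=
  fun c => `[< exists2 b, is_chain Y i.+1 b & c = bd C b >].

Lemma is_chain_zmod (R : realType) (X : finite_CW R) (A : zmodType)
  (Y : {set cell X}) (i : nat) : zmod_closed (@is_chain R X A Y i).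
Proof.
split=> [|u v /forallP uP /forallP vP].
  by apply/forallP => s; rewrite ffunE eqxx.
apply/forallP => s; apply/implyP; rewrite !ffunE.
have [us|us] := eqVneq (u s) 0; last by move=> _; exact: (implyP (uP s)).
have [vs|vs] := eqVneq (v s) 0; last by move=> _; exact: (implyP (vP s)).
by rewrite us vs subr0 eqxx.
Qed.

Lemma bd_sub (R : realType) (X : finite_CW R) (C : cellular_complex X)
  (A : zmodType) : {morph @bd R X C A : u v / u - v}.
Proof.
move=> u v; apply/ffunP => t; rewrite !ffunE -sumrB; apply: eq_bigr => s _.
by rewrite !ffunE mulrzBl.
Qed.

Lemma bd0 (R : realType) (X : finite_CW R) (C : cellular_complex X)
  (A : zmodType) : @bd R X C A 0 = 0.
Proof. by rewrite -[X in bd _ X](subrr 0) bd_sub subrr. Qed.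

Lemma is_cycle_zmod (R : realType) (X : finite_CW R) (C : cellular_complex X)
  (A : zmodType) (Y : {set cell X}) (i : nat) :
  zmod_closed (is_cycle C A Y i).
Proof.
have [c0 cB] := @is_chain_zmod R X A Y i.
split=> [|u v /andP[u1 /eqP u2] /andP[v1 /eqP v2]]; apply/andP; split.
- exact: c0.
- by rewrite bd0.
- exact: cB.
- by rewrite bd_sub u2 v2 subrr.
Qed.

HB.instance Definition _ (R : realType) (X : finite_CW R)
    (C : cellular_complex X) (A : zmodType) (Y : {set cell X}) (i : nat) :=
  GRing.isZmodClosed.Build _ (is_cycle C A Y i) (is_cycle_zmod C A Y i).

Definition cycle_group (R : realType) (X : finite_CW R) (C : cellular_complex X)
  (Y : {set cell X}) (i : nat) : Type := {c | c \in is_cycle C int Y i}.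

HB.instance Definition _ (R : realType) (X : finite_CW R)
    (C : cellular_complex X) (Y : {set cell X}) (i : nat) :=
  SubChoice.on (cycle_group C Y i).
HB.instance Definition _ (R : realType) (X : finite_CW R)
    (C : cellular_complex X) (Y : {set cell X}) (i : nat) :=
  [SubChoice_isSubZmodule of cycle_group C Y i by <:].

Definition bounding (R : realType) (X : finite_CW R) (C : cellular_complex X)
    (Y : {set cell X}) (i : nat) : {pred cycle_group C Y i} :=
  fun c => is_boundary C Y i (val c).

Lemma bounding_zmod (R : realType) (X : finite_CW R) (C : cellular_complex X)
  (Y : {set cell X}) (i : nat) : zmod_closed (@bounding R X C Y i).
Proof.
have [c0 cB] := @is_chain_zmod R X int Y i.+1.
split=> [|u v /asboolP[a a1 a2] /asboolP[b b1 b2]]; apply/asboolP.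
  by exists 0; [exact: c0|rewrite bd0 raddf0].
by exists (a - b); [exact: cB|rewrite bd_sub raddfB /= a2 b2].
Qed.

HB.instance Definition _ (R : realType) (X : finite_CW R)
    (C : cellular_complex X) (Y : {set cell X}) (i : nat) :=
  GRing.isZmodClosed.Build _ (@bounding R X C Y i) (bounding_zmod C Y i).

Definition homology (R : realType) (X : finite_CW R) (C : cellular_complex X)
    (Y : {set cell X}) (i : nat) : zmodType :=
  Quotient.quot (@bounding R X C Y i).

Definition torsion_order (R : realType) (X : finite_CW R)
    (C : cellular_complex X) (Y : {set cell X}) (i : nat) : nat :=
  #|` fset_set [set h : homology C Y i |
                exists2 n, (0 < n)%N & h *+ n = 0]%classic |.

Definition zindep (A : zmodType) (n : nat) (e : 'I_n -> A) : Prop :=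
  forall a : 'I_n -> int, \sum_i e i *~ a i = 0 -> forall i, a i = 0.

Definition zbasis (A : zmodType) (G : {pred A}) (n : nat) (e : 'I_n -> A) : Prop :=
  [/\ forall i, e i \in G, zindep e &
      forall c, c \in G -> exists a : 'I_n -> int, c = \sum_i e i *~ a i].

Definition is_zrank (A : zmodType) (G : {pred A}) (n : nat) : Prop :=
  (exists2 e : 'I_n -> A, (forall i, e i \in G) & zindep e) /\
  (forall m (e : 'I_m -> A), (forall i, e i \in G) -> zindep e -> (m <= n)%N).

Definition zrank (A : zmodType) (G : {pred A}) : nat :=
  xget 0%N [set n | is_zrank G n]%classic.

Definition cells (R : realType) (X : finite_CW R) (d : nat) : {set cell X} :=
  [set s | cdim s == d]%SET.
Arguments cells {R} X d.

Definition subcx (R : realType) (X : finite_CW R) (d : nat) (V : {set cell X}) :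
  {set cell X} := ([set s | (cdim s < d)%N] :|: V)%SET.

Definition spanning_forest (R : realType) (X : finite_CW R)
    (C : cellular_complex X) (d : nat) (V : {set cell X}) : Prop :=
  [/\ V \subset cells X d,
      #|V| = zrank (is_boundary C [set: cell X]%SET d.-1) &
      forall c : {ffun cell X -> R}, c \in is_cycle C R (subcx d V) d -> c = 0].

Definition augmented_forest (R : realType) (X : finite_CW R)
    (C : cellular_complex X) (d k : nat) (W : {set cell X}) : Prop :=
  exists V : {set cell X},
    [/\ spanning_forest C d V, V \subset W, W \subset cells X d &
        #|(W :\: V)%SET| = k].

Definition torsion_ratio (R : realType) (X : finite_CW R)
    (C : cellular_complex X) (d : nat) (W : {set cell X}) : rat :=
  (torsion_order C (subcx d W) d.-1)%:R /
  (torsion_order C [set: cell X]%SET d.-1)%:R.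

Definition pairing (R : realType) (X : finite_CW R)
  (x y : {ffun cell X -> int}) : int := \sum_s x s * y s.

Definition mesh (R : realType) (X : finite_CW R) (n : nat)
    (z : 'I_n -> {ffun cell X -> int}) : 'M[int]_n :=
  \matrix_(i, j) pairing (z i) (z j).

Definition restr (R : realType) (X : finite_CW R) (d : nat) (W : {set cell X})
    (c : {ffun cell X -> int}) : {ffun cell X -> int} :=
  [ffun s => if s \in (cells X d :\: W)%SET then c s else 0].

(* The matrix U_W of j_W in the basis z and the cells of the complement of W:
   column r holds the coefficients of j_W(z_r).  Both bases being orthonormal,
   j_W^* has matrix (jmx d z W)^T. *)
Definition jmx (R : realType) (X : finite_CW R) (d n : nat)
    (z : 'I_n -> {ffun cell X -> int}) (W : {set cell X}) :
    'M[int]_(#|(cells X d :\: W)%SET|, n) :=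
  \matrix_(i, r) restr d W (z r) (enum_val i).

(* B is the matrix of Z_d(X_W) -> Z_d(X) for some Z-basis w of Z_d(X_W) and the
   basis z. *)
Definition inclusion_mx (R : realType) (X : finite_CW R)
    (C : cellular_complex X) (d n k : nat) (z : 'I_n -> {ffun cell X -> int})
    (W : {set cell X}) (B : 'M[int]_(n, k)) : Prop :=
  exists2 w : 'I_k -> {ffun cell X -> int},
    zbasis (is_cycle C int (subcx d W) d) w &
    forall j, w j = \sum_i z i *~ B i j.

Definition eigenvalues (n : nat) (M : 'M[int]_n) : seq algC :=
  sval (closed_field_poly_normal (char_poly (map_mx intr M : 'M[algC]_n))).

Definition sigma (m n : nat) (M : 'M[int]_n) : algC :=
  let s := eigenvalues M in
  \sum_(I : {set 'I_(size s)} | #|I| == m) \prod_(i in I) s`_i.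

(* Main.v *)
(* The coefficients of the characteristic polynomial of [Z^T Z], where the columns
   of [Z] are the basis cycles, are up to sign sums of principal minors, and
   Sylvester's identity [det (1 + A B) = det (1 + B A)] moves them to [Z Z^T], whose
   principal minors are the determinants of [j_W j_W^*].  Such a determinant is
   nonzero exactly when [W] is an augmented forest.  By the Smith normal form of
   [j_W] it is then the square of the order of the cokernel of [j_W] times a minor
   of [R R^T], with [R] unimodular; the latter is [det (B^T B)] by Jacobi's
   complementary minor identity.  The boundary map identifies the cokernel of [j_W]
   with [B_(d-1)(X) / B_(d-1)(X_W)], the kernel of the surjection of the torsion of
   [H_(d-1)(X_W)] onto that of [H_(d-1)(X)]. *)

Require Import Defs.
From HB Require Import structures.
From mathcomp Require Import all_boot all_order all_algebra all_field finmap.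
From mathcomp Require Import perm zify.
From mathcomp Require Import all_classical all_reals all_analysis.

Set Implicit Arguments.
Unset Strict Implicit.
Unset Printing Implicit Defensive.

Import Order.TTheory GRing.Theory Num.Theory.
Import numFieldNormedType.Exports.

Local Open Scope ring_scope.

(** * Sylvester's identity and sums of principal minors *)

(** The block triangular matrices with diagonal blocks [1 + A B], [1] and [1], [1 + B A] are
    conjugate by the unipotent matrix with lower left block [B]. *)
Lemma det_add1_mulmxC (R : comNzRingType) (m n : nat)
    (A : 'M[R]_(m, n)) (B : 'M[R]_(n, m)) :
  \det (1%:M + A *m B) = \det (1%:M + B *m A).
Proof.
have E : block_mx (1%:M + A *m B) (- A) 0 1%:M *m block_mx 1%:M 0 B 1%:M
       = block_mx 1%:M 0 B 1%:M *m block_mx 1%:M (- A) 0 (1%:M + B *m A).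
  rewrite !mulmx_block !mulmx1 !mul1mx !mulmx0 !mul0mx !addr0 !add0r.
  by rewrite mulNmx addrK mulmxN addrCA addNr addr0.
have /(congr1 determinant) := E; rewrite !det_mulmx !det_ublock !det_lblock !det1.
by rewrite !mulr1 !mul1r.
Qed.

Lemma prod_if_set (R : comNzRingType) (I : finType) (T : {set I}) (a b : R) :
  \prod_i (if i \in T then b else a) = a ^+ (#|I| - #|T|) * b ^+ #|T|.
Proof.
rewrite (bigID (mem T)) /= mulrC; congr (_ * _).
  rewrite (eq_bigr (fun=> a)) => [|i /negPf-> //].
  rewrite big_const iter_mulr_1; congr (_ ^+ _).
  by rewrite -(cardC (mem T)) addKn.
rewrite (eq_bigr (fun=> b)) => [|i -> //].
by rewrite big_const iter_mulr_1.
Qed.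

(* The determinant of [masked T G] is the principal minor of [G] on [T]. *)
Definition masked (R : nzRingType) (n : nat) (T : {set 'I_n}) (G : 'M[R]_n) :
  'M[R]_n := \matrix_(i, j) if i \in T then G i j else (i == j)%:R.

(** Each factor in the Leibniz formula is a sum of an entry of [b *: G] and one of [a%:M]; [T]
    records the rows where the first summand is taken. *)
Lemma det_scalarD_masked (R : comNzRingType) (n : nat) (a b : R) (G : 'M[R]_n) :
  \det (a%:M + b *: G) =
  \sum_(T : {set 'I_n}) a ^+ (n - #|T|) * b ^+ #|T| * \det (masked T G).
Proof.
rewrite /determinant.
transitivity (\sum_(s : 'S_n) \sum_(T in {set 'I_n}) (-1) ^+ s *
    \prod_i (if i \in T then b * G i (s i) else a *+ (i == s i))).
  apply: eq_bigr => s _; rewrite -mulr_sumr -bigA_distr; congr (_ * _).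
  by apply: eq_bigr => i _; rewrite !mxE addrC.
rewrite exchange_big; apply: eq_big => T; first by rewrite inE.
move=> _; rewrite mulr_sumr; apply: eq_bigr => s _.
rewrite mulrCA; congr (_ * _).
transitivity (\prod_i (if i \in T then b else a) * \prod_i masked T G i (s i)).
  rewrite -big_split; apply: eq_bigr => i _; rewrite mxE /=.
  by case: ifP => // _; rewrite mulr_natr.
by rewrite prod_if_set card_ord.
Qed.

(** Stands for the [m]-th elementary symmetric function of the eigenvalues, over rings such as [int]
    that need not contain them. *)
Definition minor_sum (R : comNzRingType) (n m : nat) (G : 'M[R]_n) : R :=
  \sum_(T : {set 'I_n} | #|T| == m) \det (masked T G).

Lemma map_masked (R S : comNzRingType) (f : {rmorphism R -> S}) (n : nat)
    (T : {set 'I_n}) (G : 'M[R]_n) :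
  map_mx f (masked T G) = masked T (map_mx f G).
Proof. by apply/matrixP=> i j; rewrite !mxE; case: ifP => // _; rewrite rmorph_nat. Qed.

(** In the expansion at [a = 'X], [b = -1], only sets [T] of [n - k] rows reach degree [k]. *)
Lemma coef_char_poly_minor_sum (R : comNzRingType) (n k : nat) (G : 'M[R]_n) :
  (k <= n)%N -> (char_poly G)`_k = (-1) ^+ (n - k) * minor_sum (n - k) G.
Proof.
move=> kn; rewrite /char_poly /char_poly_mx -[- _]scaleN1r det_scalarD_masked.
rewrite coef_sum /minor_sum mulr_sumr [RHS]big_mkcond /=; apply: eq_bigr => T _.
rewrite -map_masked det_map_mx.
have -> : (-1 : {poly R}) ^+ #|T| = ((-1) ^+ #|T|)%:P by rewrite rmorphXn rmorphN.
have Tn : (#|T| <= n)%N by rewrite -[leqRHS]card_ord max_card.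
rewrite -mulrA -rmorphM mulrC coefCM coefXn.
have -> : (k == n - #|T|)%N = (#|T| == n - k)%N.
  by apply/eqP/eqP => ->; rewrite subKn.
by case: eqP => [->|_]; rewrite ?mulr1 ?mulr0.
Qed.

Lemma coef_det_1DX_minor_sum (R : comNzRingType) (n m : nat) (G : 'M[R]_n) :
  (\det (1%:M + 'X *: map_mx polyC G))`_m = minor_sum m G.
Proof.
rewrite det_scalarD_masked coef_sum [RHS]big_mkcond /=; apply: eq_bigr => T _.
rewrite -map_masked det_map_mx expr1n mul1r mulrC coefCM coefXn eq_sym.
by case: eqP; rewrite ?mulr1 ?mulr0.
Qed.

(** The two sums are coefficients of [\det (1 + X A B)] and [\det (1 + X B A)], which agree by
    Sylvester's identity even when [p] and [n] differ. *)
Lemma minor_sum_mulmxC (R : comNzRingType) (p n m : nat)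
    (A : 'M[R]_(p, n)) (B : 'M[R]_(n, p)) :
  minor_sum m (A *m B) = minor_sum m (B *m A).
Proof.
rewrite -!coef_det_1DX_minor_sum !map_mxM /= !scalemxAl det_add1_mulmxC.
by rewrite -scalemxAl -scalemxAr.
Qed.

(** * Principal minors of Gram matrices *)

(** [f] is a matrix with rows indexed by [S]. For [f s r = z r s] and [T] the [d]-cells outside [W],
    this is the matrix of [j_W]. *)
Definition subrows (R : nzRingType) (S : finType) (n : nat)
    (f : S -> 'I_n -> R) (T : {set S}) : 'M[R]_(#|T|, n) :=
  \matrix_(i, r) f (enum_val i) r.

(** With [P] the 0-1 matrix selecting the rows in [T] and [G = Z Z^T], the masked matrix is
    [1 + P^T P (G - 1)]. Sylvester's identity turns its determinant into that of
    [1 + P (G - 1) P^T], which is [P G P^T] because [P P^T = 1]. *)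
Lemma det_masked_gram (R : comNzRingType) (S : finType) (n : nat)
    (f : S -> 'I_n -> R) (T : {set S}) :
  let Z : 'M[R]_(#|S|, n) := \matrix_(i, r) f (enum_val i) r in
  \det (masked [set i | enum_val i \in T]%SET (Z *m Z^T)) =
  \det (subrows f T *m (subrows f T)^T).
Proof.
move=> Z; pose P : 'M[R]_(#|T|, #|S|) := \matrix_(i, j) (enum_val i == enum_val j)%:R.
have PPt : P *m P^T = 1%:M.
  apply/matrixP => i j; rewrite !mxE (bigD1 (enum_rank (enum_val i))) //=.
  rewrite !mxE enum_rankK eqxx mul1r big1 ?addr0 => [|k /negPf ki].
    by rewrite eq_sym (inj_eq enum_val_inj).
  by rewrite !mxE -[k]enum_valK (inj_eq enum_rank_inj) eq_sym in ki *; rewrite enum_rankK ki mul0r.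
have PZ : P *m Z = subrows f T.
  apply/matrixP => i j; rewrite !mxE (bigD1 (enum_rank (enum_val i))) //=.
  rewrite !mxE enum_rankK eqxx mul1r big1 ?addr0 => // k /negPf ki.
  by rewrite !mxE -[k]enum_valK (inj_eq enum_rank_inj) eq_sym in ki *; rewrite enum_rankK ki mul0r.
have -> : masked [set i | enum_val i \in T]%SET (Z *m Z^T) =
    1%:M + P^T *m (P *m (Z *m Z^T - 1%:M)).
  rewrite mulmxA; apply/matrixP => i j.
  have PtP k : (P^T *m P) i k = ((i == k) && (enum_val i \in T))%:R.
    rewrite mxE; have [iT|iT] := boolP (enum_val i \in T); last first.
      rewrite andbF big1 // => l _; rewrite !mxE.
      case: eqP => [E|]; last by rewrite mul0r.
      by rewrite -E enum_valP in iT.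
    rewrite (bigD1 (enum_rank_in iT (enum_val i))) //= !mxE enum_rankK_in //.
    rewrite eqxx mul1r (inj_eq enum_val_inj) andbT big1 ?addr0 // => l li.
    rewrite !mxE; case: eqP => [E|]; last by rewrite mul0r.
    by case/eqP: li; apply: enum_val_inj; rewrite enum_rankK_in.
  have PtPG (G : 'M[R]_#|S|) :
      (P^T *m P *m G) i j = if enum_val i \in T then G i j else 0.
    rewrite mxE (bigD1 i) //= PtP eqxx /= big1 ?addr0 => [|k ki]; last first.
      by rewrite PtP eq_sym (negPf ki) mul0r.
    by case: ifP => _; rewrite ?mul1r ?mul0r.
  rewrite [RHS]mxE PtPG [LHS]mxE inE; case: ifP => _; rewrite ?addr0 !mxE //.
  by rewrite addrC subrK.
rewrite det_add1_mulmxC -mulmxA mulmxBl mulmxBr mul1mx PPt addrC subrK.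
by rewrite -PZ trmx_mul !mulmxA.
Qed.

Lemma minor_sum_gram (R : comNzRingType) (S : finType) (n m : nat)
    (f : S -> 'I_n -> R) :
  let Z : 'M[R]_(#|S|, n) := \matrix_(i, r) f (enum_val i) r in
  minor_sum m (Z^T *m Z) =
  \sum_(T : {set S} | #|T| == m) \det (subrows f T *m (subrows f T)^T).
Proof.
move=> Z; rewrite minor_sum_mulmxC /minor_sum.
pose h (T : {set S}) := [set i : 'I_#|S| | enum_val i \in T]%SET.
have hK T : (enum_val @: h T)%SET = T.
  apply/setP=> s; apply/imsetP/idP => [[i]|sT]; first by rewrite inE => ? ->.
  by exists (enum_rank s); rewrite ?inE enum_rankK.
rewrite (reindex h) /=; last first.
  exists (fun T' : {set 'I_#|S|} => (enum_val @: T')%SET) => T _ //.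
  apply/setP=> i; rewrite inE mem_imset //; exact: enum_val_inj.
apply: eq_big => [T|T _]; last exact: det_masked_gram.
by rewrite -{2}(hK T) card_imset //; exact: enum_val_inj.
Qed.

(** * Elementary symmetric functions of the eigenvalues *)

(** Vieta's formulas; [T] is the set of factors that contribute their constant term. *)
Lemma coef_prod_XsubC (F : comNzRingType) (s : seq F) (k : nat) :
  (k <= size s)%N ->
  (\prod_(z <- s) ('X - z%:P))`_k = (-1) ^+ (size s - k) *
  \sum_(I : {set 'I_(size s)} | #|I| == (size s - k)%N) \prod_(i in I) s`_i.
Proof.
move=> ks; rewrite (big_nth 0) big_mkord.
under eq_bigr => i _ do rewrite addrC.
rewrite bigA_distr coef_sum mulr_sumr [RHS]big_mkcond /=.
apply: eq_big => // T _.
have -> : \prod_(i < size s) (if i \in T then - (s`_i)%:P else 'X) =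
  ((-1) ^+ #|T| * \prod_(i in T) s`_i)%:P * 'X ^+ (size s - #|T|).
  have -> : 'X^(size s - #|T|) = \prod_(i < size s) (if i \in T then 1 else 'X) :> {poly F}.
    by rewrite prod_if_set card_ord expr1n mulr1.
  rewrite -prodrN rmorph_prod /= (big_mkcond (mem T)) -big_split /=; apply: eq_bigr => i _.
  by case: ifP; rewrite ?mulr1 ?mul1r ?rmorphN.
have Tn : (#|T| <= size s)%N by rewrite -[leqRHS]card_ord max_card.
rewrite coefCM coefXn.
have -> : (k == size s - #|T|)%N = (#|T| == size s - k)%N.
  by apply/eqP/eqP => ->; rewrite subKn.
by case: eqP => [->|_]; rewrite ?mulr1 ?mulr0.
Qed.

(** Coefficient [n - m] of the characteristic polynomial over [algC] is computed twice, from the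
    roots and from the minors, with the same sign. *)
Lemma sigma_minor_sum (n m : nat) (M : 'M[int]_n) :
  (m <= n)%N -> sigma m M = (minor_sum m M)%:~R.
Proof.
move=> mn; rewrite /sigma /eigenvalues; case: closed_field_poly_normal => s /=.
rewrite (monicP (char_poly_monic _)) scale1r => Es.
have ss : size s = n.
  by have := size_char_poly (map_mx intr M : 'M[algC]_n);
    rewrite Es size_prod_XsubC => -[].
have kn : (n - m <= n)%N by apply: leq_subr.
have := congr1 (fun p : {poly algC} => p`_(n - m)) Es.
rewrite /= coef_prod_XsubC ss // coef_char_poly_minor_sum // subKn //.
move/(mulrI _) => <-; last by rewrite unitrX ?unitrN1.
rewrite /minor_sum rmorph_sum; apply: eq_bigr => T _.
by rewrite -map_masked det_map_mx.
Qed.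

(** * Linear independence over the integers *)

(** If [v A A^T = 0], the sum of the squares of the entries of [v A] is zero, so [v A = 0] over an
    ordered domain. *)
Lemma det_gram_neq0P (F : realDomainType) (m n : nat) (A : 'M[F]_(m, n)) :
  (forall v : 'rV_m, v *m A = 0 -> v = 0) <-> \det (A *m A^T) != 0.
Proof.
split=> [A_free|nz v vA].
  apply/negP => /det0P[v /eqP v0 vAA]; apply/v0/A_free.
  have : (v *m A) *m (v *m A)^T = 0 by rewrite trmx_mul !mulmxA -(mulmxA v) vAA mul0mx.
  move/matrixP/(_ 0 0); rewrite mxE [RHS]mxE => S0; apply/rowP => j; rewrite [RHS]mxE.
  move: S0; under eq_bigr => i _ do rewrite [X in _ * X]mxE -expr2.
  move/eqP; rewrite psumr_eq0 => [|i _]; last exact: sqr_ge0.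
  by move/allP/(_ j); rewrite mem_index_enum sqrf_eq0 => /(_ isT)/eqP.
apply/eqP/negPn/negP => v0; case/negP: nz; apply/det0P; exists v => //.
by rewrite mulmxA vA mul0mx.
Qed.

(** Over the rationals the Gram matrix is invertible of size [m], while its rank is at most [n]. *)
Lemma free_mx_leq (m n : nat) (A : 'M[int]_(m, n)) :
  (forall v : 'rV_m, v *m A = 0 -> v = 0) -> (m <= n)%N.
Proof.
move/det_gram_neq0P; rewrite -(intr_eq0 rat) -det_map_mx map_mxM /= => nz.
have AAu : (map_mx intr A : 'M[rat]_(m, n)) *m map_mx intr A^T \in unitmx.
  by rewrite unitmxE unitfE.
rewrite -(mxrank_unit AAu); apply: leq_trans (mxrankM_maxl _ _) _.
exact: rank_leq_col.
Qed.

(** Independence of rows, with arbitrary finite index types so that cells can serve as indices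
    directly. *)
Definition free_fam (F : nzRingType) (I J : finType) (A : I -> J -> F) : Prop :=
  forall a : I -> F, (forall j, \sum_i a i * A i j = 0) -> forall i, a i = 0.

Definition fam_mx (F : nzRingType) (I J : finType) (A : I -> J -> F) :
  'M[F]_(#|I|, #|J|) := \matrix_(i, j) A (enum_val i) (enum_val j).

Lemma free_fam_mx (F : nzRingType) (I J : finType) (A : I -> J -> F) :
  free_fam A <-> forall v : 'rV_#|I|, v *m fam_mx A = 0 -> v = 0.
Proof.
split=> [A_free v vA|A_free a aA i].
  have v0 := A_free (fun i => v 0 (enum_rank i)).
  apply/rowP => i; rewrite mxE -[i]enum_valK; apply: v0 => j.
  move/rowP/(_ (enum_rank j)): vA; rewrite !mxE => vA0; rewrite -[RHS]vA0.
  rewrite [LHS](reindex _ (onW_bij _ (enum_val_bij I))) /=; apply: eq_bigr => k _.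
  by rewrite enum_valK mxE enum_rankK.
have /A_free/rowP/(_ (enum_rank i)) : (\row_i a (enum_val i)) *m fam_mx A = 0.
  apply/rowP => j; rewrite !mxE -[RHS](aA (enum_val j)).
  rewrite [RHS](reindex _ (onW_bij _ (enum_val_bij I))) /=; apply: eq_bigr => k _.
  by rewrite !mxE.
by rewrite !mxE enum_rankK.
Qed.

Lemma free_fam_leq (I J : finType) (A : I -> J -> int) :
  free_fam A -> (#|I| <= #|J|)%N.
Proof. by move/free_fam_mx/free_mx_leq. Qed.

(** For a square family, independence of the rows and of the columns both mean a nonzero
    determinant. *)
Lemma free_fam_tr (I J : finType) (A : I -> J -> int) :
  #|I| = #|J| -> free_fam A -> free_fam (fun j i => A i j).
Proof.
move=> IJ /free_fam_mx A_free b bA.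
pose M : 'M[int]_#|I| := \matrix_(i, j) A (enum_val i) (enum_val (cast_ord IJ j)).
have : \det M != 0.
  apply/negP => /det0P[v /eqP v0 vM]; apply/v0/A_free/rowP => j.
  move/rowP/(_ (cast_ord (esym IJ) j)): vM; rewrite !mxE => vA0; rewrite -[RHS]vA0.
  by apply: eq_bigr => i _; rewrite !mxE cast_ordKV.
rewrite -det_tr => nz j.
have : \row_i b (enum_val (cast_ord IJ i)) = 0.
  apply/eqP/negPn/negP => b0; case/negP: nz; apply/det0P.
  exists (\row_i b (enum_val (cast_ord IJ i))) => //.
  apply/rowP => i; rewrite !mxE -[RHS](bA (enum_val i)).
  have bij : bijective (fun k : 'I_#|I| => enum_val (cast_ord IJ k)).
    apply: bij_comp; first exact: enum_val_bij.
    by exists (cast_ord (esym IJ)) => k; rewrite ?cast_ordK ?cast_ordKV.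
  by rewrite [RHS](reindex _ (onW_bij _ bij)) /=; apply: eq_bigr => k _; rewrite !mxE.
move/rowP/(_ (cast_ord (esym IJ) (enum_rank j))).
by rewrite !mxE cast_ordKV enum_rankK.
Qed.

(** The Gram determinant over [F] is the image of the integral one, so it stays nonzero. *)
Lemma free_fam_intr (F : realDomainType) (I J : finType) (A : I -> J -> int) :
  free_fam A -> free_fam (fun i j => (A i j)%:~R : F).
Proof.
move/free_fam_mx/det_gram_neq0P; rewrite -(intr_eq0 F) -det_map_mx map_mxM /=.
rewrite -map_trmx => /det_gram_neq0P A_free; apply/free_fam_mx => v vA.
apply: A_free; rewrite -[RHS]vA; congr (_ *m _).
by apply/matrixP => i j; rewrite !mxE.
Qed.

Lemma free_subrowsP (S : finType) (n : nat) (f : S -> 'I_n -> int) (T : {set S}) :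
  (forall a : S -> int, (forall r, \sum_(s in T) a s * f s r = 0) ->
     forall s, s \in T -> a s = 0)
  <-> \det (subrows f T *m (subrows f T)^T) != 0.
Proof.
split=> [f_free|/det_gram_neq0P f_free a af s sT].
  apply/det_gram_neq0P => v vf; apply/rowP => i; rewrite mxE.
  have := f_free (fun s => v 0 (enum_rank_in (enum_valP i) s)) _ _ (enum_valP i).
  rewrite enum_valK_in; apply=> r.
  rewrite big_enum_val.
  move/rowP/(_ r): vf; rewrite !mxE => vA0; rewrite -[RHS]vA0.
  by apply: eq_bigr => k _; rewrite enum_valK_in mxE.
have /f_free/rowP/(_ (enum_rank_in sT s)) : (\row_i a (enum_val i)) *m subrows f T = 0.
  apply/rowP => r; rewrite !mxE -[RHS](af r).
  by rewrite [RHS]big_enum_val; apply: eq_bigr => k _; rewrite !mxE.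
by rewrite !mxE enum_rankK_in.
Qed.

(** * Smith normal form and Gram determinants *)

(* Jacobi's complementary minor identity. *)
Lemma det_ulsubmx_inv (R : comNzRingType) (m k : nat) (P Q : 'M[R]_(m + k)) :
  P *m Q = 1%:M -> \det (ulsubmx P) = \det P * \det (drsubmx Q).
Proof.
move=> PQ; have := PQ.
rewrite -[P in P *m _]submxK -[Q in _ *m Q]submxK mulmx_block.
rewrite scalar_mx_block => /eq_block_mx[_ E12 _ E22].
have /(congr1 determinant) : P *m block_mx 1%:M (ursubmx Q) 0 (drsubmx Q) =
    block_mx (ulsubmx P) 0 (dlsubmx P) 1%:M.
  by rewrite -[P in LHS]submxK mulmx_block !mulmx1 !mulmx0 !addr0 E12 E22.
by rewrite det_mulmx det_ublock det_lblock !det1 mulr1 mul1r.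
Qed.

Lemma sqr_det_unitmx (n : nat) (A : 'M[int]_n) : A \in unitmx -> \det A * \det A = 1.
Proof.
by rewrite unitmxE => /orP[] /eqP ->.
Qed.

(** The zero block leaves [U U^T = L D G D^T L^T], with [D] the diagonal matrix of [d] and [G] the
    upper left block of [R R^T]; [\det L] is a sign. *)
Lemma gram_smith (m k : nat) (L : 'M[int]_m) (R : 'M[int]_(m + k)) (d : 'rV[int]_m)
    (U : 'M[int]_(m, m + k)) :
  L \in unitmx -> U = L *m row_mx (diag_mx d) 0 *m R ->
  \det (U *m U^T) = (\prod_i d 0 i) ^+ 2 * \det (ulsubmx (R *m R^T)).
Proof.
move=> /sqr_det_unitmx L1 ->; set D := diag_mx d.
have -> : L *m row_mx D 0 *m R *m (L *m row_mx D 0 *m R)^T =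
    L *m (D *m ulsubmx (R *m R^T) *m D^T) *m L^T.
  rewrite !trmx_mul tr_row_mx trmx0 !mulmxA; congr (_ *m _).
  rewrite -!mulmxA; congr (_ *m _); rewrite !mulmxA -(mulmxA _ R) -[R *m _]submxK.
  by rewrite mul_row_block !mul0mx !addr0 mul_row_col mulmx0 addr0 block_mxKul.
rewrite !det_mulmx !det_tr mulrAC L1 mul1r det_diag mulrAC -expr2.
by [].
Qed.

(** A vanishing invariant factor would make the Gram determinant zero. *)
Lemma smith_full_rank (m k : nat) (U : 'M[int]_(m, m + k)) :
  \det (U *m U^T) != 0 ->
  exists (L : 'M[int]_m) (R : 'M[int]_(m + k)) (d : 'rV[int]_m),
    [/\ L \in unitmx, R \in unitmx, forall i, d 0 i != 0 &
        U = L *m row_mx (diag_mx d) 0 *m R].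
Proof.
move=> nz; have [L Lu [R Ru [s _ EU]]] := int_Smith_normal_form U.
have EU' : U = L *m row_mx (diag_mx (\row_i s`_i)) 0 *m R.
  rewrite EU; congr (_ *m _ *m _); apply/matrixP => i j; rewrite !mxE.
  case: splitP => l jl; rewrite !mxE jl.
    by rewrite (_ : (i == l :> nat) = (i == l)).
  by rewrite (_ : (i == m + l :> nat) = false) // ltn_eqF // ltn_addr.
(* [s] may have fewer than [m] entries; a missing one reads as 0 and is excluded in the same way. *)
exists L, R, (\row_i s`_i); split=> // i; apply: contraNneq nz => di.
by rewrite (gram_smith Lu EU') (bigD1 i) //= di mul0r expr0n mul0r.
Qed.

(** The kernel of [U] consists of the [v] such that the first [m] entries of [R v] vanish. Hence
    [R B] is a zero block above a unimodular [Y], and [B^T B = Y^T Q' Y] with [Q'] the lower right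
    block of the inverse of [R R^T]. Jacobi's identity concludes, as [\det (R R^T) = 1]. *)
Lemma gram_kernel_basis (m k : nat) (L : 'M[int]_m) (R : 'M[int]_(m + k))
    (d : 'rV[int]_m) (U : 'M[int]_(m, m + k)) (B : 'M[int]_(m + k, k)) :
  L \in unitmx -> R \in unitmx -> (forall i, d 0 i != 0) ->
  U = L *m row_mx (diag_mx d) 0 *m R ->
  U *m B = 0 -> (forall v : 'cV_(m + k), U *m v = 0 -> exists a, v = B *m a) ->
  \det (B^T *m B) = \det (ulsubmx (R *m R^T)).
Proof.
move=> Lu Ru d0 EU UB0 Bker.
pose Q := (invmx R)^T *m invmx R.
have PQ : (R *m R^T) *m Q = 1%:M.
  by rewrite /Q trmx_inv !mulmxA mulmxK ?unitmx_tr // mulmxV.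
have EB : B = invmx R *m col_mx 0 (dsubmx (R *m B)).
  rewrite -[B in LHS](mulKmx Ru); congr (_ *m _).
  rewrite -[R *m B in LHS]vsubmxK; congr col_mx.
  move: UB0; rewrite EU -!mulmxA => /(congr1 (mulmx (invmx L))).
  rewrite mulmx0 mulKmx // -[R *m B in LHS]vsubmxK mul_row_col mul0mx addr0.
  move=> DY; apply/matrixP => i j; move/matrixP/(_ i j): DY.
  by rewrite mul_diag_mx !mxE => /eqP; rewrite mulf_eq0 (negPf (d0 i)) => /eqP.
set Y := dsubmx _ in EB.
(* The last [k] columns of [invmx R] lie in the kernel, so they are combinations of the columns of
   [B]; this gives a right inverse of [Y]. *)
have Yu : Y \in unitmx.
  have H (j : 'I_k) : exists a, invmx R *m col_mx 0 (col j 1%:M) = B *m a.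
    apply: Bker; rewrite EU -mulmxA mulKVmx // -mulmxA mul_row_col mulmx0 mul0mx.
    by rewrite addr0 mulmx0.
  have [a Ha] := fin_all_exists H.
  have : Y *m (\matrix_(i, j) a j i 0) = 1%:M.
    apply/matrixP => i j.
    have := Ha j; rewrite EB -mulmxA => /(congr1 (mulmx R)).
    rewrite !mulKVmx // mul_col_mx mul0mx => /eq_col_mx[_ /colP/(_ i)].
    rewrite mxE => ->; rewrite !mxE.
    by apply: eq_bigr => l _; rewrite !mxE.
  by case/mulmx1_unit.
have -> : B^T *m B = Y^T *m drsubmx Q *m Y.
  rewrite EB trmx_mul tr_col_mx trmx0 -!mulmxA (mulmxA (invmx R)^T) -/Q.
  rewrite -[Q in LHS]submxK mul_block_col !mulmx0 !add0r mul_row_col mul0mx add0r.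
  by rewrite !mulmxA.
rewrite (det_ulsubmx_inv PQ) !det_mulmx !det_tr sqr_det_unitmx // mul1r.
by rewrite mulrAC sqr_det_unitmx // mul1r.
Qed.

(** Up to [L], the image of [U] is the product of the ideals generated by the [d 0 i], so vectors of
    remainders modulo the [d 0 i] represent each coset exactly once. *)
Lemma smith_transversal (m k : nat) (L : 'M[int]_m) (R : 'M[int]_(m + k))
    (d : 'rV[int]_m) (U : 'M[int]_(m, m + k)) :
  L \in unitmx -> R \in unitmx -> (forall i, d 0 i != 0) ->
  U = L *m row_mx (diag_mx d) 0 *m R ->
  exists x : 'I_(\prod_i `|d 0%R i|)%N -> 'cV[int]_m,
    (forall y, exists e v, y = x e + U *m v) /\
    (forall e e' v, x e = x e' + U *m v -> e = e').
Proof.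
move=> Lu Ru d0 EU.
pose E := fprod (fun i : 'I_m => 'I_`|d 0%R i|%N).
have cE : #|{: E}| = (\prod_i `|d 0%R i|)%N.
  by rewrite card_fprod; apply: eq_bigr => i _; rewrite card_ord.
rewrite -cE; exists (fun e : 'I_#|{: E}| => L *m \col_i ((enum_val e : E) i : nat)%:Z); split.
  move=> y; pose w := invmx L *m y.
  have r_lt i : (`|(w i 0%R %% d 0%R i)%Z| < `|d 0%R i|)%N.
    by rewrite -ltz_nat gez0_abs ?modz_ge0 // abszE ltz_mod.
  exists (enum_rank [fprod i : 'I_m => Ordinal (r_lt i)]).
  exists (invmx R *m col_mx (\col_i (w i 0%R %/ d 0%R i)%Z) 0).
  rewrite EU enum_rankK -!mulmxA mulKVmx // mul_row_col mul0mx addr0 -mulmxDr.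
  rewrite -[LHS](mulKVmx Lu) -/w; congr (_ *m _).
  apply/colP => i; rewrite mul_diag_mx !mxE fprodE /= gez0_abs ?modz_ge0 //.
  have -> : \sum_j invmx L i j * y j 0 = w i 0 by rewrite mxE.
  by rewrite mulrC addrC -divz_eq.
move=> e e' v Ee; apply: enum_val_inj; apply/fprodP => i; apply: val_inj => /=.
have := Ee; rewrite EU -!mulmxA -mulmxDr => /(congr1 (mulmx (invmx L))).
rewrite !mulKmx // -[R *m v]vsubmxK mul_row_col mul0mx addr0 => /colP/(_ i).
rewrite mul_diag_mx !mxE => /(congr1 (fun t => (t %% d 0%R i)%Z)).
rewrite mulrC addrC modzMDl -!(modz_abs _ (d 0 i)) !modz_nat !modn_small //.
by case.
Qed.

(* The [x e] represent the cosets of the image of [U] in [Z^m]; for [U] the matrix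
   of [j_W], their number [N] is the torsion ratio. *)
Lemma full_rank_transversal (m k : nat) (U : 'M[int]_(m, m + k)) :
  \det (U *m U^T) != 0 ->
  exists (N : nat) (x : 'I_N -> 'cV[int]_m),
   [/\ (0 < N)%N,
       forall y, exists e v, y = x e + U *m v,
       forall e e' v, x e = x e' + U *m v -> e = e' &
       forall B : 'M[int]_(m + k, k), U *m B = 0 ->
         (forall v : 'cV_(m + k), U *m v = 0 -> exists a, v = B *m a) ->
         \det (U *m U^T) = N%:R ^+ 2 * \det (B^T *m B)].
Proof.
move=> /smith_full_rank[L [R [d [Lu Ru d0 EU]]]].
have [x [x_cover x_inj]] := smith_transversal Lu Ru d0 EU.
exists (\prod_i `|d 0%R i|)%N, x; split=> //.
  by apply: prodn_gt0 => i; rewrite absz_gt0.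
move=> B UB0 Bker; rewrite (gram_smith Lu EU) (gram_kernel_basis Lu Ru d0 EU UB0 Bker).
congr (_ * _); rewrite natr_prod -!prodrXl; apply: eq_bigr => i _.
by rewrite natz abszE real_normK ?num_real.
Qed.

(** * Forests, ranks and nonvanishing Gram determinants *)

HB.instance Definition _ (R : realType) (X : finite_CW R)
    (C : cellular_complex X) (A : zmodType) :=
  GRing.isZmodMorphism.Build {ffun cell X -> A} {ffun cell X -> A} (@bd R X C A)
    (@bd_sub R X C A).

Lemma zcombE (I : finType) (n : nat) (e : 'I_n -> {ffun I -> int})
    (a : 'I_n -> int) (s : I) :
  (\sum_i e i *~ a i) s = \sum_i a i * e i s.
Proof.
rewrite sum_ffunE; apply: eq_bigr => i _.
have -> : (e i *~ a i) s = e i s *~ a i.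
  by case: (a i) => m; rewrite ?NegzE ?mulrNz -?pmulrn ?ffunE ffunMnE.
by rewrite mulrzz mulrC.
Qed.

(** [zrank] is a chosen value; any two ranks bound each other, which pins the choice down. *)
Lemma zrank_unique (A : zmodType) (G : {pred A}) (n : nat) :
  is_zrank G n -> zrank G = n.
Proof.
move=> [[e eG e_indep] n_max]; apply: xget_unique; first by split=> //; exists e.
move=> m [[f fG f_indep] m_max]; apply/eqP.
by rewrite eqn_leq (n_max _ f) // (m_max _ e).
Qed.

Section Forests.

Variables (R : realType) (X : finite_CW R) (C : cellular_complex X) (d : nat).

Lemma is_chainP (A : zmodType) (Y : {set cell X}) (i : nat) (c : {ffun cell X -> A}) :
  reflect (forall s, c s != 0 -> s \in Y /\ cdim s = i) (is_chain Y i c).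
Proof.
apply: (iffP forallP) => c_on s.
  by move=> cs; have /implyP/(_ cs)/andP[? /eqP] := c_on s.
by apply/implyP => /c_on[-> /eqP].
Qed.

Lemma chain_subcxP (A : zmodType) (V : {set cell X}) (c : {ffun cell X -> A}) :
  V \subset cells X d ->
  reflect (forall s, s \notin V -> c s = 0) (is_chain (subcx d V) d c).
Proof.
move=> /fintype.subsetP Vd; apply: (iffP (is_chainP _ _ _)) => c_on s.
  move=> sV; apply/eqP/negPn/negP => /c_on[].
  by rewrite !inE (negPf sV) orbF => + E; rewrite E ltnn.
move=> cs; have sV : s \in V by apply: contraNT cs => /c_on ->.
by split; [rewrite !inE sV orbT|have := Vd _ sV; rewrite inE => /eqP].
Qed.

Lemma chain_setTP (A : zmodType) (c : {ffun cell X -> A}) :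
  reflect (forall s, s \notin cells X d -> c s = 0) (is_chain [set: cell X]%SET d c).
Proof.
apply: (iffP (is_chainP _ _ _)) => c_on s.
  by rewrite inE => sd; apply/eqP/negPn/negP => /c_on[_ /eqP]; apply/negP.
move=> cs; split; first by rewrite inE.
by apply/eqP; apply: contraNT cs => sd; rewrite c_on ?inE.
Qed.

Lemma cycle_subcxP (A : zmodType) (V : {set cell X}) (c : {ffun cell X -> A}) :
  V \subset cells X d ->
  reflect ((forall s, s \notin V -> c s = 0) /\ bd C c = 0)
    (c \in is_cycle C A (subcx d V) d).
Proof.
move=> Vd; apply: (iffP andP) => [[/(chain_subcxP _ Vd) c_on /eqP]|[c_on bdc]] //.
by split; [apply/(chain_subcxP _ Vd)|apply/eqP].
Qed.

Lemma cycle_setTP (A : zmodType) (c : {ffun cell X -> A}) :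
  reflect ((forall s, s \notin cells X d -> c s = 0) /\ bd C c = 0)
    (c \in is_cycle C A [set: cell X]%SET d).
Proof.
apply: (iffP andP) => [[/chain_setTP c_on /eqP]|[c_on bdc]] //.
by split; [apply/chain_setTP|apply/eqP].
Qed.

(** The cycle condition on spanning forests, with coefficients left open: [R] in the definition of a
    forest, [int] in the computations. *)
Definition acyclic (A : zmodType) (V : {set cell X}) : Prop :=
  forall c : {ffun cell X -> A}, c \in is_cycle C A (subcx d V) d -> c = 0.

(** Acyclicity says that a homogeneous linear system with integer coefficients has only the zero
    solution, which is the same over the integers and the reals. *)
Lemma acyclic_intr (V : {set cell X}) :
  V \subset cells X d -> acyclic int V <-> acyclic R V.
Proof.
move=> Vd; split=> [V_acyc|V_acyc] c /(cycle_subcxP _ Vd)[c_on bdc].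
  (* The indices [inr t] turn the support condition into integer equations. *)
  pose A (s : cell X) (j : cell X + cell X) : int := match j with
    | inl t => inc C s t | inr t => ((s == t) && (s \notin V))%:R end.
  have Ainr (F : nzRingType) (a : cell X -> F) t :
      \sum_s a s * (A s (inr t))%:~R = if t \in V then 0 else a t.
    rewrite (bigD1 t) //= eqxx /= big1 ?addr0 => [|s /negPf ->].
      by case: ifP; rewrite ?mulr0 ?mulr1.
    by rewrite mulr0.
  have A_free : free_fam A.
    move=> a aA; have /ffunP a0 : [ffun s => a s] = 0.
      apply/V_acyc/(cycle_subcxP _ Vd); split=> [s sV|].
        rewrite ffunE -[RHS](aA (inr s)).
        under eq_bigr => t _ do rewrite -[A _ _]intz.
        by rewrite Ainr (negPf sV).
      apply/ffunP => t; rewrite !ffunE -[RHS](aA (inl t)); apply: eq_bigr => s _.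
      by rewrite ffunE -mulrzr intz.
    by move=> s; have := a0 s; rewrite !ffunE.
  apply/ffunP => s; rewrite [RHS]ffunE.
  apply: (free_fam_intr (F := R) A_free) => -[t|t].
    have /ffunP/(_ t) := bdc; rewrite !ffunE => bdct; rewrite -[RHS]bdct.
    by apply: eq_bigr => u _; rewrite mulrzr.
  by rewrite Ainr; case: ifPn => // /c_on.
have /ffunP c0 : [ffun s => (c s)%:~R : R] = 0.
  apply/V_acyc/(cycle_subcxP _ Vd); split=> [s /c_on cs|]; first by rewrite ffunE cs.
  apply/ffunP => t; have /ffunP/(_ t) := bdc; rewrite !ffunE => /(congr1 (intr : int -> R)).
  rewrite rmorph_sum rmorph0 /= => bdct; rewrite -[RHS]bdct; apply: eq_bigr => s _.
  by rewrite ffunE -mulrzr -[X in _ = (X)%:~R]mulrzr intz intrM.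
by apply/ffunP => s; have /eqP := c0 s; rewrite !ffunE intr_eq0 => /eqP.
Qed.

Variables (n : nat) (z : 'I_n -> {ffun cell X -> int}).
Hypothesis z_basis : zbasis (is_cycle C int [set: cell X]%SET d) z.

Local Notation gram W :=
  (subrows (fun s r => z r s) (cells X d :\: W) *m
     (subrows (fun s r => z r s) (cells X d :\: W))^T).

Lemma jmxE (W : {set cell X}) :
  jmx d z W = subrows (fun s r => z r s) (cells X d :\: W).
Proof. by apply/matrixP => i r; rewrite !mxE ffunE enum_valP. Qed.

(** A combination of basis cycles that vanishes off [V] is a cycle on [V], hence zero; so the [n]
    basis cycles stay independent when restricted to the complement. *)
Lemma acyclic_card_ge (V : {set cell X}) :
  V \subset cells X d -> acyclic int V -> (n <= #|cells X d :\: V|)%N.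
Proof.
move=> Vd V_acyc; have [z_cyc z_indep _] := z_basis.
pose f s r := z r s.
apply: (free_mx_leq (A := (subrows f (cells X d :\: V))^T)) => v vf.
suff /z_indep v0 : \sum_i z i *~ v 0 i = 0 by apply/rowP => i; rewrite v0 mxE.
apply/V_acyc/(cycle_subcxP _ Vd).
have /cycle_setTP[c_on bdc] : \sum_i z i *~ v 0 i \in is_cycle C int [set: cell X]%SET d.
  by apply: rpred_sum => i _; apply: rpredMz.
split=> // s sV; have [sd|/c_on //] := boolP (s \in cells X d).
have sdV : s \in cells X d :\: V by rewrite inE sV.
rewrite zcombE; have /rowP/(_ (enum_rank_in sdV s)) := vf.
rewrite !mxE => vfs; rewrite -[RHS]vfs; apply: eq_bigr => i _.
by rewrite !mxE enum_rankK_in.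
Qed.

(* For [V] maximal acyclic in [W], every cell of [W] outside [V] lies on a cycle
   supported on [V] and that cell, so that the rows of the mesh basis on the
   complement of [V] are independent. *)
Lemma forest_in (W : {set cell X}) :
  W \subset cells X d -> \det (gram W) != 0 ->
  exists V : {set cell X}, [/\ V \subset W, acyclic int V & #|cells X d :\: V| = n].
Proof.
move=> Wd /free_subrowsP W_free; have [z_cyc z_indep z_gen] := z_basis.
pose P (V : {set cell X}) := `[< V \subset W /\ acyclic int V >].
have P0 : P finset.set0.
  apply/asboolP; split=> [|c]; first exact: finset.sub0set.
  move=> /(cycle_subcxP _ (finset.sub0set _))[c0 _]; apply/ffunP => s.
  by rewrite c0 ?inE // ffunE.
have [V /maxsetP[/asboolP[VW V_acyc] V_max] _] := maxset_exists P0.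
have Vd := fintype.subset_trans VW Wd.
exists V; split=> //; apply/eqP; rewrite eqn_leq acyclic_card_ge // andbT.
pose f s r := z r s.
apply: (free_mx_leq (A := subrows f (cells X d :\: V))).
apply/det_gram_neq0P/free_subrowsP => a af.
(* A relation [a] between these rows is a functional that annihilates every cycle. *)
have a_cyc c : c \in is_cycle C int [set: cell X]%SET d ->
    \sum_(s in cells X d :\: V) a s * c s = 0.
  move=> /z_gen[b ->]; under eq_bigr => s _ do rewrite zcombE mulr_sumr.
  rewrite exchange_big big1 //= => i _.
  under eq_bigr => s _ do rewrite mulrCA.
  by rewrite -mulr_sumr af mulr0.
(* By maximality some cycle on [s |: V] is nonzero at [s], and [s] is its only cell outside [V];
   evaluating the functional there isolates [a s]. *)
have aW s : s \in W :\: V -> a s = 0.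
  rewrite inE => /andP[sV sW].
  have sVW : s |: V \subset W by rewrite finset.subUset finset.sub1set sW.
  have /existsNP[c /not_implyP[c_cyc c0]] : ~ acyclic int (s |: V).
    move=> sV_acyc; have : s |: V = V by apply: V_max; [exact/asboolP|exact: finset.subsetUr].
    by move/finset.setP/(_ s); rewrite !inE eqxx (negPf sV).
  have sVd := fintype.subset_trans sVW Wd.
  have /(cycle_subcxP _ sVd)[c_on bdc] := c_cyc.
  have cs : c s != 0.
    apply/eqP => cs0; apply/c0/V_acyc/(cycle_subcxP _ Vd); split=> // t tV.
    have [->//|ts] := eqVneq t s; apply: c_on.
    by rewrite !inE (negPf ts).
  have : \sum_(s in cells X d :\: V) a s * c s = 0.
    apply/a_cyc/cycle_setTP; split=> // t td; apply: c_on; apply: contra td.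
    exact/fintype.subsetP.
  rewrite (bigD1 s) /=; last by rewrite inE sV (fintype.subsetP Wd).
  rewrite big1 ?addr0 => [/eqP|t /andP[]]; first by rewrite mulf_eq0 (negPf cs) orbF => /eqP.
  rewrite inE => /andP[tV _] ts; rewrite c_on ?mulr0 //.
  by rewrite !inE (negPf ts).
move=> s; rewrite inE => /andP[sV sd].
have [sW|sW] := boolP (s \in W); first by apply: aW; rewrite inE sV.
(* What remains of the relation involves only rows outside [W], independent by assumption. *)
apply: W_free; last by rewrite inE sW.
move=> r; rewrite -[RHS](af r) [RHS](bigID (fun t => t \notin W)) /=.
rewrite [X in _ + X]big1 ?addr0 => [|t /andP[]]; last first.
  by rewrite inE negbK => /andP[tV _] tW; rewrite aW ?mul0r // inE tV.
apply: eq_bigl => t; rewrite !inE.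
case: (boolP (t \in W)) => tW; rewrite ?andbF // andbT.
by rewrite (contra (fintype.subsetP VW t)).
Qed.

(** On the complement of [V] the basis cycles form a square family with independent columns, hence
    with independent rows; the rows outside [W] are some of these. *)
Lemma acyclic_gram_neq0 (V W : {set cell X}) :
  V \subset W -> W \subset cells X d -> acyclic int V -> #|cells X d :\: V| = n ->
  \det (gram W) != 0.
Proof.
move=> VW Wd V_acyc cV; have Vd := fintype.subset_trans VW Wd.
have [z_cyc z_indep _] := z_basis.
pose J := {s | s \in cells X d :\: V}.
pose A (i : 'I_n) (s : J) := z i (val s).
have A_free : free_fam A.
  move=> a aA; apply/z_indep/V_acyc/(cycle_subcxP _ Vd).
  have /cycle_setTP[c_on bdc] : \sum_i z i *~ a i \in is_cycle C int [set: cell X]%SET d.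
    by apply: rpred_sum => i _; apply: rpredMz.
  split=> // s sV; have [sd|/c_on //] := boolP (s \in cells X d).
  have sdV : s \in cells X d :\: V by rewrite inE sV.
  by rewrite zcombE; apply: (aA (exist _ s sdV)).
have cIJ : #|'I_n| = #|{: J}| by rewrite card_ord card_sig -[LHS]cV; apply: eq_card => s.
have At_free := free_fam_tr cIJ A_free.
apply/free_subrowsP => a af s; rewrite inE => /andP[sW sd].
have sdV : s \in cells X d :\: V by rewrite inE sd (contra (fintype.subsetP VW s)).
(* A relation between the rows outside [W] is extended by zero to the rows outside [V]. *)
pose b (t : J) := if val t \in W then 0 else a (val t).
suff : b (exist _ s sdV) = 0 by rewrite /b /= (negPf sW).
apply: At_free => r; rewrite -[RHS](af r).
rewrite -(big_sub (fun s => s \in cells X d :\: V)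
  (fun t => (if t \in W then 0 else a t) * z r t)) /=.
rewrite (bigID (mem W)) /= big1 ?add0r => [|t /andP[_ ->]]; last by rewrite mul0r.
apply: eq_big => t; last by move=> /andP[_ /negPf ->].
rewrite !inE; case: (boolP (t \in W)) => tW; rewrite ?andbF // andbT.
by rewrite (contra (fintype.subsetP VW t)).
Qed.

(** Rank-nullity for the boundary map on [d]-chains. Cells of an acyclic [V] whose complement has
    [n] cells have independent boundaries; conversely, lifts of independent boundaries together with
    the basis cycles are independent chains, which bounds their number. *)
Lemma zrank_boundaries : (0 < d)%N ->
  (zrank (is_boundary C [set: cell X]%SET d.-1) + n)%N = #|cells X d|.
Proof.
move=> d_gt0; have [z_cyc z_indep _] := z_basis.
have [V [Vd V_acyc cV]] : exists V : {set cell X},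
    [/\ V \subset cells X d, acyclic int V & #|cells X d :\: V| = n].
  (* For [W] the set of all [d]-cells there are no rows, and independence is vacuous. *)
  apply: forest_in => //; apply/free_subrowsP => a _ s.
  by rewrite inE => /andP[/negPf ->].
have EN : #|cells X d| = (#|V| + n)%N by rewrite -cV -(cardsID V) (finset.setIidPr Vd).
rewrite EN; congr (_ + n)%N; apply: zrank_unique; split.
  pose delta s : {ffun cell X -> int} := [ffun t => (t == s)%:R].
  exists (fun i => bd C (delta (enum_val i))) => [i|a].
    apply/asboolP; exists (delta (enum_val i)) => //; rewrite prednK //.
    apply/chain_setTP => s sd; rewrite ffunE; case: eqP => // Es.
    by rewrite Es (fintype.subsetP Vd) ?enum_valP in sd.
  under eq_bigr => i _ do rewrite -raddfMz.
  rewrite -raddf_sum => bdc j.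
  have /ffunP/(_ (enum_val j)) : \sum_i delta (enum_val i) *~ a i = 0.
    apply/V_acyc/(cycle_subcxP _ Vd); split=> // s sV.
    rewrite zcombE big1 // => i _; rewrite ffunE; case: eqP => [Es|]; last by rewrite mulr0.
    by rewrite Es enum_valP in sV.
  rewrite zcombE (bigD1 j) //= !ffunE eqxx mulr1 big1 ?addr0 // => i ij.
  by rewrite ffunE (inj_eq enum_val_inj) eq_sym (negPf ij) mulr0.
move=> m e e_bd e_indep.
have /fin_all_exists[b eb] i : exists b : {ffun cell X -> int},
    is_chain [set: cell X]%SET d b /\ e i = bd C b.
  by have /asboolP[b b1 b2] := e_bd i; exists b; rewrite -[d]prednK.
(* The lifts [b i] and the basis cycles in one family; applying the boundary to a relation kills the
   cycles and leaves a relation between the [e i]. *)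
pose A (i : 'I_m + 'I_n) (s : {s | s \in cells X d}) : int :=
  match i with inl i => b i (val s) | inr i => z i (val s) end.
suff /free_fam_leq : free_fam A.
  have -> : #|{: {s | s \in cells X d}}| = (#|V| + n)%N.
    by rewrite card_sig -EN; apply: eq_card => s.
  by rewrite card_sum !card_ord leq_add2r.
move=> a aA.
pose x := \sum_i b i *~ a (inl i); pose y := \sum_i z i *~ a (inr i).
have /cycle_setTP[y_on bdy] : y \in is_cycle C int [set: cell X]%SET d.
  by apply: rpred_sum => i _; apply: rpredMz.
have xy0 : x + y = 0.
  apply/ffunP => s; rewrite !ffunE; have [sd|sd] := boolP (s \in cells X d).
    by rewrite -[RHS](aA (exist _ s sd)) big_sumType !zcombE.
  rewrite y_on // addr0 zcombE big1 // => i _.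
  by have [/chain_setTP -> //] := eb i; rewrite mulr0.
have al : forall i, a (inl i) = 0.
  apply: e_indep; under eq_bigr => i _ do rewrite (eb i).2 -raddfMz.
  rewrite -raddf_sum -/x /= (_ : x = - y) ?raddfN /= ?bdy ?oppr0 //.
  by apply/eqP; rewrite -addr_eq0 xy0.
have ar : forall i, a (inr i) = 0.
  apply: z_indep; rewrite -[RHS]xy0 -/y /x big1 ?add0r // => i _.
  by rewrite al mulr0z.
by case.
Qed.

(** Trades the rank and the real cycles of the definition for a cell count and a determinant;
    [forest_in] supplies the forest inside [W] in the converse. *)
Lemma augmented_forestP (k : nat) (W : {set cell X}) : (0 < d)%N ->
  augmented_forest C d k W <->
  [/\ W \subset cells X d, (#|cells X d :\: W| + k)%N = n & \det (gram W) != 0].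
Proof.
move=> d_gt0; have EN := zrank_boundaries d_gt0.
have cardD (V : {set cell X}) : V \subset cells X d ->
    (#|V| + #|cells X d :\: V|)%N = #|cells X d|.
  by move=> Vd; rewrite -(cardsID V (cells X d)) (finset.setIidPr Vd).
have cardW (V : {set cell X}) : V \subset W ->
    (#|V| + #|W :\: V|)%N = #|W|.
  by move=> Vd; rewrite -(cardsID V W) (finset.setIidPr Vd).
split=> [[V [[Vd cV V_acyc] VW Wd ck]]|[Wd ck nz]].
  have cVn : #|cells X d :\: V| = n.
    by apply/eqP; rewrite -(eqn_add2l #|V|) cardD // cV EN.
  have Va : acyclic int V by apply/acyclic_intr.
  split=> //; last exact: acyclic_gram_neq0 VW Wd Va cVn.
  by have := cardD _ Wd; have := cardW _ VW; have := EN; rewrite ck cV; lia.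
have [V [VW V_acyc cVn]] := forest_in Wd nz.
have Vd := fintype.subset_trans VW Wd.
have cV := cardD _ Vd; exists V; split=> //.
  split=> //; first by move: cV EN; rewrite cVn; lia.
  by apply/acyclic_intr.
by have := cardD _ Wd; have := cardW _ VW; move: cV EN; rewrite cVn; lia.
Qed.

Lemma spanning_augmented (V : {set cell X}) :
  spanning_forest C d V <-> augmented_forest C d 0 V.
Proof.
split=> [V_sf|[W [W_sf WV _ /eqP]]].
  by exists V; split; rewrite ?finset.setDv ?cards0 //; case: V_sf.
rewrite cards_eq0 finset.setD_eq0 => VW.
by rewrite (_ : V = W) //; apply/eqP; rewrite finset.eqEsubset VW.
Qed.

End Forests.

(** * Torsion of the homology of [X] and of its subcomplexes *)

(** [fset_set] is meaningful only on finite sets, so finiteness of [B] is derived first, as the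
    image of the product of [A] and [I]. *)
Lemma card_fset_set_pairs (T U : choiceType) (I : finType) (A : set T) (B : set U)
    (f : T -> I -> U) :
  finite_set A -> (forall a b i j, f a i = f b j -> a = b /\ i = j) ->
  (forall u, B u <-> exists a i, A a /\ u = f a i) ->
  #|` fset_set B| = (#|` fset_set A| * #|I|)%N.
Proof.
move=> fA f_inj fB.
have finB : finite_set B.
  have -> : B = ((fun p => f p.1 p.2) @` (A `*` [set: I]))%classic.
    apply/seteqP; split=> u; first by move/fB => [a [i [Aa ->]]]; exists (a, i).
    by move=> [[a i] [/= Aa _] <-]; apply/fB; exists a, i.
  by apply: finite_image; apply: finite_setX => //; exact: finite_finset.
rewrite cardE -(size_allpairs f (fset_set A) (enum I)).
apply/perm_size/uniq_perm; first exact: fset_uniq.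
  apply: allpairs_uniq; [exact: fset_uniq|exact: enum_uniq|].
  by move=> [a i] [b j] _ _ /= /f_inj[-> ->].
move=> u; rewrite in_fset_set //; apply/idP/allpairsP => [|[[a i] /= [aA _ ->]]].
  rewrite inE => /fB[a [i [Aa ->]]]; exists (a, i) => /=.
  by rewrite mem_enum in_fset_set // inE.
by rewrite inE; apply/fB; exists a, i; move: aA; rewrite in_fset_set // inE.
Qed.

Section Torsion.

Variables (R : realType) (X : finite_CW R) (C : cellular_complex X).

Lemma is_chainB (A : zmodType) (Y : {set cell X}) (i : nat)
    (u v : {ffun cell X -> A}) :
  is_chain Y i u -> is_chain Y i v -> is_chain Y i (u - v).
Proof. exact: (@is_chain_zmod R X A Y i).2. Qed.

Lemma is_chainN (A : zmodType) (Y : {set cell X}) (i : nat) (u : {ffun cell X -> A}) :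
  is_chain Y i u -> is_chain Y i (- u).
Proof.
by move=> u_on; rewrite -[- u]sub0r; apply: is_chainB => //; exact: (@is_chain_zmod R X A Y i).1.
Qed.

Lemma is_chainD (A : zmodType) (Y : {set cell X}) (i : nat)
    (u v : {ffun cell X -> A}) :
  is_chain Y i u -> is_chain Y i v -> is_chain Y i (u + v).
Proof. by move=> u_on v_on; rewrite -[v]opprK; apply: is_chainB => //; exact: is_chainN. Qed.

Lemma is_chainMn (A : zmodType) (Y : {set cell X}) (i m : nat)
    (u : {ffun cell X -> A}) :
  is_chain Y i u -> is_chain Y i (u *+ m).
Proof.
move=> u_on; elim: m => [|m IH]; last by rewrite mulrS is_chainD.
by rewrite mulr0n; exact: (@is_chain_zmod R X A Y i).1.
Qed.

Lemma bd_is_cycle (i : nat) (b : {ffun cell X -> int}) :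
  is_chain [set: cell X]%SET i.+1 b -> bd C b \in is_cycle C int [set: cell X]%SET i.
Proof.
move=> /is_chainP b_on; apply/andP; split; last first.
  apply/eqP/ffunP => u; rewrite !ffunE.
  under eq_bigr => t _ do rewrite ffunE mulrz_suml.
  rewrite exchange_big big1 //= => s _.
  transitivity (b s * \sum_t inc C s t * inc C t u); last by rewrite inc_inc mulr0.
  by rewrite mulr_sumr; apply: eq_bigr => t _; rewrite !mulrzz mulrA.
apply/is_chainP => t; rewrite inE => bt; split=> //.
have [s] : exists s, b s *~ inc C s t != 0.
  apply/existsP; apply: contraNT bt => /existsPn b0; rewrite ffunE big1 // => s _.
  by apply/eqP/negPn/b0.
rewrite mulrzz mulf_eq0 negb_or => /andP[/b_on[_ si] /inc_cdim].
by rewrite si => -[].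
Qed.

Lemma cycle_subcx_lt (d i : nat) (W : {set cell X}) : (i < d)%N ->
  is_cycle C int (subcx d W) i =i is_cycle C int [set: cell X]%SET i.
Proof.
move=> id c; rewrite !unfold_in; congr (_ && _).
by apply/is_chainP/is_chainP => c_on s /c_on[? si]; rewrite !inE ?si ?id.
Qed.

Definition hclass (Y : {set cell X}) (i : nat) (c : cycle_group C Y i) :
  homology C Y i := \pi_(Quotient.quot (@bounding R X C Y i))%qT c.

Lemma hclass_surj (Y : {set cell X}) (i : nat) (h : homology C Y i) :
  exists c, h = hclass c.
Proof. by exists (repr (h : Quotient.quot (@bounding R X C Y i))); rewrite /hclass reprK. Qed.

Lemma hclass_eq (Y : {set cell X}) (i : nat) (c c' : cycle_group C Y i) :
  hclass c = hclass c' <-> exists2 b, is_chain Y i.+1 b & val c - val c' = bd C b.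
Proof.
have E := Quotient.idealrBE (@bounding R X C Y i) c c'.
split=> [/eqP|[b b1 b2]]; first by rewrite -E => /asboolP[b b1 b2]; exists b.
by apply/eqP; rewrite -E; apply/asboolP; exists b.
Qed.

Lemma torsionP (Y : {set cell X}) (i : nat) (c : cycle_group C Y i) :
  (exists2 m, (0 < m)%N & hclass c *+ m = 0) <->
  (exists m b, [/\ (0 < m)%N, is_chain Y i.+1 b & val c *+ m = bd C b]).
Proof.
have E m : hclass c *+ m = 0 <->
    exists2 b, is_chain Y i.+1 b & val c *+ m = bd C b.
  have -> : hclass c *+ m = hclass (c *+ m) by rewrite /hclass raddfMn.
  have -> : 0 = hclass (0 : cycle_group C Y i) by rewrite /hclass raddf0.
  have E : val (c *+ m) - val (0 : cycle_group C Y i) = val c *+ m.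
    by rewrite -raddfB subr0 raddfMn.
  by rewrite hclass_eq E.
by split=> [[m m0 /E[b ? ?]]|[m [b [? ? ?]]]]; exists m => //; [exists b|apply/E; exists b].
Qed.

(* Reducing the coefficients of a bounding chain modulo the order bounds the
   coefficients of a representative, hence the number of torsion classes. *)
Lemma finite_torsion (i : nat) :
  finite_set [set h : homology C [set: cell X]%SET i |
    exists2 m, (0 < m)%N & h *+ m = 0]%classic.
Proof.
set Y := [set: cell X]%SET.
pose K := (\sum_s \sum_t `|inc C s t|)%N.
(* The shift by [K] makes the values range from [-K] to [K]; functions that are not cycles go to the
   class of 0. *)
pose g (f : {ffun cell X -> 'I_(K + K).+1}) : homology C Y i :=
  hclass (insubd 0 [ffun t => (f t)%:Z - K%:Z]).
apply: (@sub_finite_set _ _ (g @` [set: _])%classic); last first.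
  by apply: finite_image; exact: finite_finset.
move=> h; have [c ->] := hclass_surj h => /torsionP[m [b [m0 b_on bE]]].
pose q : {ffun cell X -> int} := [ffun s => (b s %/ m)%Z].
have q_on : is_chain Y i.+1 q.
  apply/is_chainP => s; rewrite ffunE => qs; have /is_chainP := b_on; apply.
  by apply: contraNneq qs => ->; rewrite div0z.
pose c' := val c - bd C q.
have c'_cyc : c' \in is_cycle C int Y i by rewrite rpredB ?(valP c) ?bd_is_cycle.
have c'_le t : (`|c' t| <= K)%N.
  (* [m] times [c'] is the boundary of the chain of remainders, all smaller than [m]. *)
  rewrite -(leq_pmul2l m0) -[X in (X * `|c' t|)%N]/(`|m%:Z|%N) -abszM.
  have -> : m%:Z * c' t = \sum_s (b s %% m)%Z * inc C s t.
    have /ffunP/(_ t) := bE; rewrite ffunMnE !ffunE mulrBr -mulr_natl natz => ->.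
    rewrite mulr_sumr -sumrB; apply: eq_bigr => s _; rewrite ffunE.
    by rewrite !mulrzz mulrA -mulrBl /modz [m%:Z * _]mulrC.
  rewrite /K big_distrr; elim/big_ind2: _ => // [x p y r xp yr|s _].
    by apply: leq_trans (leq_add xp yr); lia.
  rewrite abszM leq_mul //; last by rewrite (bigD1 t) //= leq_addr.
  have := ltz_pmod (b s) (_ : 0 < m%:Z); have := modz_ge0 (b s) (_ : m%:Z != 0); lia.
exists [ffun t => inord `|(c' t + K%:Z)%R|%N] => //; rewrite /g.
have -> : [ffun t => ([ffun t => inord `|(c' t + K%:Z)%R|%N : 'I_(K + K).+1] t)%:Z - K%:Z] = c'.
  apply/ffunP => t; rewrite !ffunE inordK; have := c'_le t; rewrite /c' !ffunE; lia.
apply/hclass_eq; exists (- q); first exact: is_chainN.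
by rewrite insubdK // raddfN /c' /= addrAC subrr add0r.
Qed.

Variables (d n : nat) (z : 'I_n -> {ffun cell X -> int}) (W : {set cell X}).
Hypotheses (d_gt0 : (0 < d)%N) (Wd : W \subset cells X d).
Hypothesis z_basis : zbasis (is_cycle C int [set: cell X]%SET d) z.

Let T := cells X d :\: W.
Let U : 'M[int]_(#|T|, n) := subrows (fun s r => z r s) T.

Definition restrict_col (u : {ffun cell X -> int}) : 'cV[int]_#|T| :=
  \col_i u (enum_val i).

Definition extend_col (y : 'cV[int]_#|T|) : {ffun cell X -> int} :=
  [ffun s => \sum_i (s == enum_val i)%:R * y i 0].

Lemma restrict_colB : {morph restrict_col : u v / u - v}.
Proof. by move=> u v; apply/colP => j; rewrite !mxE !ffunE. Qed.

Lemma extend_colK : cancel extend_col restrict_col.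
Proof.
move=> y; apply/colP => i; rewrite mxE ffunE (bigD1 i) //= eqxx mul1r.
rewrite big1 ?addr0 // => j ji.
by rewrite (inj_eq enum_val_inj) eq_sym (negPf ji) mul0r.
Qed.

Lemma extend_col_chain (y : 'cV[int]_#|T|) :
  is_chain [set: cell X]%SET d (extend_col y).
Proof.
apply/chain_setTP => s sd; rewrite ffunE big1 // => i _.
case: eqP => [Es|]; last by rewrite mul0r.
by have := enum_valP i; rewrite -Es inE (negPf sd) andbF.
Qed.

(** Chains with equal boundaries differ by a cycle, and chains on [W] restrict to zero off [W]. This
    identifies the cokernel of [j_W] with boundaries of [X] modulo boundaries of [X_W]. *)
Lemma bounds_subcxP (u : {ffun cell X -> int}) :
  is_chain [set: cell X]%SET d u ->
  (exists2 w, is_chain (subcx d W) d w & bd C u = bd C w) <->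
  (exists v, restrict_col u = U *m v).
Proof.
move=> u_on; have [z_cyc _ z_gen] := z_basis.
have Uv (a : 'I_n -> int) : restrict_col (\sum_i z i *~ a i) = U *m \col_i a i.
  apply/colP => j; rewrite mxE zcombE mxE; apply: eq_bigr => i _.
  by rewrite !mxE mulrC.
split=> [[w /(chain_subcxP _ Wd) w_on buw]|[v uv]].
  have /z_gen[a uw] : u - w \in is_cycle C int [set: cell X]%SET d.
    apply/cycle_setTP; split; last by rewrite raddfB /= buw subrr.
    apply/chain_setTP/is_chainB => //; apply/chain_setTP => s sd; apply: w_on.
    by apply: contra sd; apply: fintype.subsetP.
  exists (\col_i a i); rewrite -Uv -uw restrict_colB [restrict_col w](_ : _ = 0) ?subr0 //.
  apply/colP => j; rewrite !mxE w_on //.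
  by have := enum_valP j; rewrite inE => /andP[].
pose y := \sum_i z i *~ v i 0.
have /cycle_setTP[y_on bdy] : y \in is_cycle C int [set: cell X]%SET d.
  by apply: rpred_sum => i _; apply: rpredMz.
exists (u - y); last by rewrite raddfB /= bdy subr0.
apply/(chain_subcxP _ Wd) => s sW; rewrite !ffunE.
have [sd|sd] := boolP (s \in cells X d); last first.
  by have /chain_setTP u0 := u_on; rewrite y_on // u0 // subr0.
have sT : s \in T by rewrite inE sW.
have : restrict_col u = restrict_col y.
  by rewrite uv Uv; congr (_ *m _); apply/colP => i; rewrite mxE.
move/colP/(_ (enum_rank_in sT s)); rewrite !mxE enum_rankK_in // => ->.
by rewrite subrr.
Qed.

(* The torsion classes of the subcomplex are the sums of a representative of a
   torsion class of [X] and of the boundary of one of the chains [x e]. *)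
Lemma torsion_order_subcx (N : nat) (x : 'I_N -> 'cV[int]_#|T|) :
  \det (U *m U^T) != 0 ->
  (forall y, exists e v, y = x e + U *m v) ->
  (forall e e' v, x e = x e' + U *m v -> e = e') ->
  torsion_order C (subcx d W) d.-1 =
    (torsion_order C [set: cell X]%SET d.-1 * N)%N.
Proof.
move=> nz x_cover x_inj; set Y := [set: cell X]%SET.
have chain_sub (u : {ffun cell X -> int}) : is_chain (subcx d W) d u -> is_chain Y d u.
  move=> /(chain_subcxP _ Wd) u_on; apply/chain_setTP => s sd; apply: u_on.
  by apply: contra sd; apply: fintype.subsetP.
have cyc_eq : is_cycle C int (subcx d W) d.-1 =i is_cycle C int Y d.-1.
  by apply: cycle_subcx_lt; rewrite prednK.
have bd_cyc u : is_chain Y d u -> bd C u \in is_cycle C int Y d.-1.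
  by move=> u_on; rewrite bd_is_cycle // prednK.
pose D := \det (U *m U^T).
(* By the adjugate of [U U^T], [D] times any column lies in the image of [U]; the square makes the
   multiplier nonnegative. *)
have bd_mul (u : {ffun cell X -> int}) : is_chain Y d u ->
    exists2 w, is_chain (subcx d W) d w & bd C (u *+ `|(D * D)%R|%N) = bd C w.
  move=> u_on; apply/bounds_subcxP; first exact: is_chainMn.
  exists (D *: (U^T *m (\adj (U *m U^T) *m restrict_col u))).
  rewrite -scalemxAr !mulmxA mul_mx_adj mul_scalar_mx scalerA.
  apply/colP => j; rewrite !mxE ffunMnE -mulr_natl natz gez0_abs //.
  by rewrite -expr2 sqr_ge0.
pose rep (h : homology C Y d.-1) : cycle_group C Y d.-1 :=
  repr (h : Quotient.quot (@bounding R X C Y d.-1)).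
have repK h : hclass (rep h) = h by rewrite /hclass /rep reprK.
(* The default 0 of [insubd] is never reached: the sum is always a cycle, by [FE]. *)
pose F h e : homology C (subcx d W) d.-1 :=
  hclass (insubd 0 (val (rep h) + bd C (extend_col (x e)))).
have FE h e : val (insubd 0 (val (rep h) + bd C (extend_col (x e))) :
    cycle_group C (subcx d W) d.-1) = val (rep h) + bd C (extend_col (x e)).
  by rewrite insubdK // cyc_eq rpredD ?(valP (rep h)) ?bd_cyc ?extend_col_chain.
rewrite /torsion_order (card_fset_set_pairs (f := F) (finite_torsion d.-1)).
- by rewrite card_ord.
- move=> h h' e e' /hclass_eq[w]; rewrite prednK // !FE => w_on.
  move=> E; have w_on' := chain_sub _ w_on.
  have E1 : val (rep h) - val (rep h') =
      bd C (w - (extend_col (x e) - extend_col (x e'))).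
    by rewrite !bd_sub -E [- (_ + _)]opprD addrACA addrK.
  (* Equal classes in the subcomplex are equal in [X], where the boundaries of the [x e] disappear;
     only then are [e] and [e'] compared. *)
  have hh' : h = h'.
    rewrite -[h]repK -[h']repK; apply/hclass_eq; rewrite prednK //.
    by eexists; last exact: E1; rewrite !is_chainB ?extend_col_chain.
  split=> //; move: E; rewrite hh' opprD addrACA subrr add0r -raddfB => E.
  have [|v] := (bounds_subcxP (is_chainB (extend_col_chain (x e)) (extend_col_chain (x e')))).1.
    by exists w.
  rewrite restrict_colB !extend_colK => xx; apply: (x_inj _ _ v).
  by rewrite -xx addrC subrK.
move=> h; split=> [|[h0 [e [h0_tors ->]]]].
  have [c ->] := hclass_surj h => /torsionP[m [b [m0]]].
  rewrite prednK // => b_on bE.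
  pose c' : cycle_group C Y d.-1 := insubd 0 (val c).
  have c'E : val c' = val c by rewrite insubdK // -cyc_eq (valP c).
  have [u] : exists2 u, is_chain Y d u & val c - val (rep (hclass c')) = bd C u.
    have /hclass_eq[u] : hclass c' = hclass (rep (hclass c')) by rewrite repK.
    by rewrite prednK // c'E => ? ?; exists u.
  move=> u_on uE; have [e [v uv]] := x_cover (restrict_col u).
  exists (hclass c'), e; split.
    apply/torsionP; exists m, b; rewrite prednK // c'E; split=> //.
    exact: chain_sub.
  apply/hclass_eq; rewrite FE prednK // opprD addrA uE -raddfB.
  apply/bounds_subcxP; first by rewrite is_chainB ?extend_col_chain.
  by exists v; rewrite restrict_colB extend_colK uv addrC addKr.
(* A multiple of the representative bounds in [X], hence by [bd_mul] a further multiple bounds in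
   the subcomplex. *)
move: h0_tors; rewrite -[h0 in X in X -> _]repK => /torsionP[m [b [m0]]].
rewrite prednK // => b_on bE; apply/torsionP; rewrite FE prednK //.
have bx_on := is_chainD b_on (is_chainMn m (extend_col_chain (x e))).
have [w w_on wE] := bd_mul _ bx_on.
exists (m * `|(D * D)%R|)%N, w; split=> //.
  by rewrite muln_gt0 m0 absz_gt0 mulf_neq0.
by rewrite -wE mulrnA mulrnDl bE -raddfMn -raddfD -raddfMn.
Qed.

End Torsion.

(** * Covolumes and torsion ratios *)

Section TorsionRatio.

Variables (R : realType) (X : finite_CW R) (C : cellular_complex X) (d : nat).
Hypothesis d_gt0 : (0 < d)%N.

Lemma torsion_order_gt0 (i : nat) : (0 < torsion_order C [set: cell X]%SET i)%N.
Proof.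
rewrite /torsion_order cardfs_gt0; apply/fset0Pn; exists 0.
rewrite in_fset_set; last exact: finite_torsion.
by rewrite inE; exists 1%N; rewrite ?mul0rn.
Qed.

(** A cycle that vanishes on the [d]-cells outside [W] is a cycle of [X_W], so the columns of [B]
    generate the kernel of [j_W]. *)
Lemma inclusion_mx_kernel (n k : nat) (z : 'I_n -> {ffun cell X -> int})
    (W : {set cell X}) (B : 'M[int]_(n, k)) :
  zbasis (is_cycle C int [set: cell X]%SET d) z -> W \subset cells X d ->
  inclusion_mx C d z W B ->
  jmx d z W *m B = 0 /\
  (forall v : 'cV_n, jmx d z W *m v = 0 -> exists a, v = B *m a).
Proof.
move=> [z_cyc z_indep z_gen] Wd [w [w_cyc _ w_gen] wE]; rewrite jmxE; split.
  apply/matrixP => i j; rewrite !mxE.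
  have /(cycle_subcxP _ _ Wd)[w_on _] := w_cyc j.
  have := w_on (enum_val i); rewrite wE zcombE => w0.
  transitivity (\sum_l B l j * z l (enum_val i)).
    by apply: eq_bigr => l _; rewrite mxE mulrC.
  by apply: w0; have := enum_valP i; rewrite inE => /andP[].
move=> v zv; pose y := \sum_i z i *~ v i 0.
have /cycle_setTP[y_on bdy] : y \in is_cycle C int [set: cell X]%SET d.
  by apply: rpred_sum => i _; apply: rpredMz.
have /w_gen[a ya] : y \in is_cycle C int (subcx d W) d.
  apply/(cycle_subcxP _ _ Wd); split=> // s sW.
  have [sd|/y_on //] := boolP (s \in cells X d).
  have sT : s \in cells X d :\: W by rewrite inE sW.
  have /colP/(_ (enum_rank_in sT s)) := zv; rewrite !mxE zcombE => zvs.
  by rewrite -[RHS]zvs; apply: eq_bigr => i _; rewrite mxE enum_rankK_in // mulrC.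
exists (\col_j a j); apply/colP => i; apply/eqP; rewrite -subr_eq0; apply/eqP.
move: i; apply: z_indep.
under eq_bigr => i _ do rewrite mulrzBr.
rewrite sumrB -/y ya; apply/eqP; rewrite subr_eq0; apply/eqP.
under eq_bigr => j _ do rewrite wE mulrz_suml.
rewrite exchange_big; apply: eq_bigr => i _ /=.
rewrite mxE mulrz_sumr; apply: eq_bigr => j _.
by rewrite mxE mulrzA.
Qed.

(** [N] is the index of the image of [j_W]; the same [N] serves the integrality of the ratio and the
    covolume formula. *)
Lemma torsion_ratio_index (n k : nat) (z : 'I_n -> {ffun cell X -> int})
    (W : {set cell X}) :
  zbasis (is_cycle C int [set: cell X]%SET d) z -> augmented_forest C d k W ->
  exists N : nat, [/\ (0 < N)%N, torsion_ratio C d W = N%:R &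
    forall B : 'M[int]_(n, k), inclusion_mx C d z W B ->
      \det (jmx d z W *m (jmx d z W)^T) = N%:R ^+ 2 * \det (B^T *m B)].
Proof.
(* Substituting the cell count plus [k] for [n] gives the matrix of [j_W] the shape [m] by
   [m + k]. *)
move=> z_basis /(augmented_forestP z_basis _ _ d_gt0)[Wd En]; subst n => nz.
have [N [x [N0 x_cover x_inj N_det]]] := full_rank_transversal nz.
exists N; split=> // [|B B_incl].
  rewrite /torsion_ratio (torsion_order_subcx d_gt0 Wd z_basis nz x_cover x_inj).
  by rewrite natrM mulrAC mulfV ?mul1r // pnatr_eq0 -lt0n torsion_order_gt0.
have := inclusion_mx_kernel z_basis Wd B_incl; rewrite jmxE => -[UB0 Bker].
exact: N_det.
Qed.

Lemma det_jmx_torsion (n k : nat) (z : 'I_n -> {ffun cell X -> int})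
    (W : {set cell X}) (B : 'M[int]_(n, k)) :
  zbasis (is_cycle C int [set: cell X]%SET d) z -> augmented_forest C d k W ->
  inclusion_mx C d z W B ->
  (\det (jmx d z W *m (jmx d z W)^T))%:~R =
    torsion_ratio C d W ^+ 2 * (\det (B^T *m B))%:~R.
Proof.
move=> z_basis W_aug B_incl.
have [N [_ -> /(_ _ B_incl) ->]] := torsion_ratio_index z_basis W_aug.
by rewrite rmorphM rmorphXn /= rmorph_nat.
Qed.

Lemma det_jmx_spanning (n : nat) (z : 'I_n -> {ffun cell X -> int})
    (V : {set cell X}) :
  zbasis (is_cycle C int [set: cell X]%SET d) z -> spanning_forest C d V ->
  (\det (jmx d z V *m (jmx d z V)^T))%:~R = torsion_ratio C d V ^+ 2.
Proof.
move=> z_basis V_sf; have [Vd _ V_acyc] := V_sf.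
have /(acyclic_intr _ Vd) {}V_acyc : acyclic C d R V by [].
(* There are no cycles on [V], so the empty family is a basis and the inclusion matrix has no
   columns; its Gram determinant is 1. *)
rewrite (@det_jmx_torsion n 0 z V 0) //; last 2 first.
- exact/spanning_augmented.
- exists (fun=> 0); last by case.
  split=> [[] //|a _ [] //|c /V_acyc ->]; exists (fun=> 0).
  by rewrite big_ord0.
by rewrite det_mx00 mulr1.
Qed.

(** The mesh matrix is [Z^T Z], so the minors are Gram determinants of rows of [Z]; they are indexed
    by the complement of [W], and those with dependent rows vanish. *)
Lemma minor_sum_mesh (n k : nat) (z : 'I_n -> {ffun cell X -> int}) :
  zbasis (is_cycle C int [set: cell X]%SET d) z -> (k <= n)%N ->
  minor_sum (n - k) (mesh z) =
  \sum_(W : {set cell X} | `[< augmented_forest C d k W >])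
     \det (jmx d z W *m (jmx d z W)^T).
Proof.
move=> z_basis kn; have [z_cyc _ _] := z_basis.
pose f s r := z r s; pose Z : 'M[int]_(#|cell X|, n) := \matrix_(i, r) f (enum_val i) r.
have -> : mesh z = Z^T *m Z.
  apply/matrixP => i j; rewrite !mxE /pairing.
  rewrite (reindex _ (onW_bij _ (enum_val_bij _))) /=.
  by apply: eq_bigr => s _; rewrite !mxE.
rewrite (minor_sum_gram _ f) (bigID (fun T : {set cell X} => T \subset cells X d)) /=.
(* A cell of dimension other than [d] gives a zero row. *)
rewrite [X in _ + X]big1 ?addr0 => [|T /andP[_ Td]]; last first.
  apply/eqP/negPn/negP => /free_subrowsP f_free; case/negP: Td.
  apply/fintype.subsetP => s sT; apply: contraT => sd.
  suff : (s == s)%:R = 0 :> int by rewrite eqxx.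
  apply: (f_free (fun t => (t == s)%:R)) => // r.
  rewrite (bigD1 s) //= eqxx mul1r big1 ?addr0 => [|t /andP[_ /negPf ->]].
    by have /cycle_setTP[z_on _] := z_cyc r; rewrite /f z_on.
  by rewrite mul0r.
have DD (T : {set cell X}) : T \subset cells X d -> cells X d :\: (cells X d :\: T) = T.
  by move=> /finset.setIidPr Td; rewrite finset.setDDr finset.setDv finset.set0U.
rewrite (reindex_onto (fun W => cells X d :\: W) (fun T => cells X d :\: T)) /=; last first.
  by move=> T /andP[_ /DD].
rewrite big_mkcond [RHS]big_mkcond; apply: eq_bigr => W _; rewrite jmxE.
case: asboolP => [/(augmented_forestP z_basis _ _ d_gt0)[Wd cW _]|W_naug].
  have -> : (#|cells X d :\: W| == n - k)%N by rewrite -cW addnK.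
  by rewrite DD // eqxx finset.subsetDl.
case: ifP => // /andP[/andP[/eqP cW _] /eqP DW].
apply/eqP/negPn/negP => nz; apply/W_naug/(augmented_forestP z_basis _ _ d_gt0).
by split=> //; [rewrite -DW finset.subsetDl|rewrite cW subnK].
Qed.

(** Both sides are the constant coefficient of the characteristic polynomial up to the sign
    [(-1) ^+ n]. *)
Lemma minor_sum_full (n : nat) (M : 'M[int]_n) : minor_sum n M = \det M.
Proof.
have := coef_char_poly_minor_sum M (leq0n n).
by rewrite char_poly_det subn0 => /(mulrI _) <- //; rewrite unitrX ?unitrN1.
Qed.

End TorsionRatio.

(** * Coefficients of the characteristic polynomial of the mesh matrix *)

Theorem theorem2p1 (R : realType) (X : finite_CW R) (C : cellular_complex X)
    (d : nat) (hd : (1 <= d)%N)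
    (zd : nat) (hzd : zd = zrank (is_cycle C int [set: cell X]%SET d))
    (z : 'I_zd -> {ffun cell X -> int})
    (hz : zbasis (is_cycle C int [set: cell X]%SET d) z) :
  [/\ (* (1) *)
      [/\ ((-1) ^+ zd *: char_poly (mesh z))`_0 = \det (mesh z),
          (\det (mesh z))%:~R = sigma zd (mesh z),
          (\det (mesh z))%:~R =
            \sum_(V : {set cell X} | `[< spanning_forest C d V >])
               torsion_ratio C d V ^+ 2
        & forall V : {set cell X}, spanning_forest C d V ->
            (\det (jmx d z V *m (jmx d z V)^T))%:~R = torsion_ratio C d V ^+ 2],
      (* (2) *)
      forall (k : nat) (B : {set cell X} -> 'M[int]_(zd, k)),
        (0 < k < zd)%N ->
        (forall W, augmented_forest C d k W -> inclusion_mx C d z W (B W)) ->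
        (((-1) ^+ (zd - k) *: char_poly (mesh z))`_k)%:~R
          = sigma (zd - k) (mesh z) /\
        sigma (zd - k) (mesh z) =
          ratr (\sum_(W : {set cell X} | `[< augmented_forest C d k W >])
                  torsion_ratio C d W ^+ 2 * (\det ((B W)^T *m B W))%:~R),
      (* (3) *)
      forall (k : nat) (W : {set cell X}) (B : 'M[int]_(zd, k)),
        (k < zd)%N -> augmented_forest C d k W -> inclusion_mx C d z W B ->
        (\det (jmx d z W *m (jmx d z W)^T))%:~R =
          torsion_ratio C d W ^+ 2 * (\det (B^T *m B))%:~R
    & (* (4) *)
      forall (k : nat) (W : {set cell X}),
        (k <= zd)%N -> augmented_forest C d k W ->
        exists2 m : nat, (0 < m)%N & torsion_ratio C d W = m%:R].
Proof.
have sgn2 m (a : int) : (-1) ^+ m * ((-1) ^+ m * a) = a.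
  by rewrite mulrA -exprD addnn -mul2n exprM sqrrN expr1n mul1r.
split.
- split.
  + by rewrite coefZ char_poly_det sgn2.
  + by rewrite sigma_minor_sum // minor_sum_full.
  + have := minor_sum_mesh hd hz (leq0n zd); rewrite subn0 minor_sum_full => ->.
    rewrite rmorph_sum /=.
    apply: eq_big => V; first by apply/asboolP/asboolP => /spanning_augmented.
    by move=> /asboolP/spanning_augmented/(det_jmx_spanning hd hz).
  + by move=> V; exact: det_jmx_spanning.
- move=> k B /andP[_ /ltnW kzd] B_incl; rewrite sigma_minor_sum ?leq_subr //; split.
    by rewrite coefZ coef_char_poly_minor_sum // sgn2.
  (* The integer is sent to [algC] through [rat], where the torsion ratios live. *)
  rewrite (minor_sum_mesh hd hz) // -ratr_int rmorph_sum /=; congr ratr.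
  apply: eq_bigr => W /asboolP W_aug.
  by rewrite (det_jmx_torsion hd hz W_aug (B_incl _ W_aug)).
- by move=> k W B _; exact: det_jmx_torsion.
move=> k W _ /(torsion_ratio_index hd hz)[N [N0 NE _]].
by exists N.
Qed.
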